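(* Let $\xi<\omega_1$ be a countable ordinal and $0<\theta<1$. For every $x\in c_{00}$, $$\|x\|_{\mathcal{S}_\xi,\theta,M}\leqslant\|x\|_{\mathcal{S}_\xi[\mathcal{A}_2],\theta},$$ and $$\|x\|_{\mathcal{S}_\xi,\theta}\leqslant\|x\|_{\mathcal{S}_\xi,\theta,M}\leqslant3\|x\|_{\mathcal{S}_\xi,\theta}.$$
   Context: Notation: $[\mathbb{N}]^{<\omega}$ is the set of finite subsets of $\mathbb{N}=\{1,2,\dots\}$. For sets $A,B$ of positive integers, $A<B$ means $a<b$ for all $a\in A,b\in B$; for $m\in\mathbb N$, $m\leqslant A$ means $m\leqslant\min A$ and $m<A$ means $m<\min A$. Conventions: $\max\emptyset=0$, $\min\emptyset=\infty$. Schreier families $\mathcal{S}_\xi\subset[\mathbb{N}]^{<\omega}$, $\xi<\omega_1$: $\mathcal{S}_0=\{\{n\}:n\in\mathbb{N}\}\cup\{\emptyset\}$. If $\xi=\gamma+1$, then $\mathcal{S}_\xi$ consists of $\emptyset$ and all sets $\bigcup_{i=1}^nE_i$ with $n\in\mathbb N$, $E_1,\dots,E_n\in\mathcal{S}_\gamma$ nonempty and $n\leqslant E_1<E_2<\cdots<E_n$. If $\xi$ is a limit ordinal, a sequence of successor ordinals $(\alpha(\xi,n))_{n=1}^\infty\subset[1,\xi)$ increasing to $\xi$ is fixed, and $\mathcal{S}_\xi=\{E:\exists n\leqslant \min E\text{ with }E\in\mathcal{S}_{\alpha(\xi,n)}\}$. These sequences are chosen (which is possible) such that for every limit ordinal $\xi<\omega_1$: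 $\alpha(\xi,1)=1$, and for all $n\in\mathbb{N}$, if $A,B\in\mathcal{S}_{\alpha(\xi,n)}$ with $1<A<B$, then $A\cup B\in\mathcal{S}_{\alpha(\xi,n+1)}$. For a family $\mathcal{F}\subset[\mathbb{N}]^{<\omega}$, a finite sequence $(E_i)_{i=1}^k$ of (nonempty) finite subsets of $\mathbb{N}$ is $\mathcal{F}$-admissible if $E_1<\cdots<E_k$ and $\{\min E_i:1\leqslant i\leqslant k\}\in\mathcal{F}$; it is $\mathcal{F}$-allowable if the $E_i$ are pairwise disjoint and $\{\min E_i:1\leqslant i\leqslant k\}\in\mathcal{F}$. For families $\mathcal{M},\mathcal{N}$: $\mathcal{M}[\mathcal{N}]=\{\bigcup_{i=1}^kF_i:F_i\in\mathcal{N},\ (F_i)_{i=1}^k\ \mathcal{M}\text{-admissible}\}$. $\mathcal{A}_n=\{E\subset\mathbb{N}:|E|\leqslant n\}$. $c_{00}$ is the space of finitely supported real sequences; for $E\subset\mathbb{N}$ and $x\in c_{00}$, $Ex$ is the coordinate restriction of $x$ to $E$. The norm $\|\cdot\|_{\mathcal{F},\theta}$ on $c_{00}$ is the unique norm satisfying $\|x\|=\max\{\|x\|_\infty,\theta\sup\{\sum_{i=1}^k\|E_ix\|:(E_i)_{i=1}^k\ \mathcal{F}\text{-admissible}\}\}$, and $\|\cdot\|_{\mathcal{F},\theta,M}$ is the unique norm satisfying $\|x\|=\max\{\|x\|_\infty,\theta\sup\{\sum_{i=1}^k\|E_ix\|:(E_i)_{i=1}^k\ \mathcal{F}\text{-allowable}\}\}$.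 Their completions are the Tsirelson space $T[\mathcal{F},\theta]$ and the modified Tsirelson space $T_M[\mathcal{F},\theta]$. *)

(* Defs.v *)
From mathcomp Require Import all_boot all_order all_algebra finmap.
From mathcomp Require Import all_classical all_reals ereal.

Set Implicit Arguments.
Unset Strict Implicit.
Unset Printing Implicit Defensive.

Import Order.TTheory GRing.Theory Num.Theory.

Local Open Scope classical_set_scope.
Local Open Scope ring_scope.

(** The set of positive integers is represented inside [nat]: its finite
    subsets are the [E : {fset nat}] with [posset E], and a sequence indexed
    by it is an [x : nat -> R] with [x 0 = 0] (see [c00]). *)

Definition posset : set {fset nat} := [set E | 0%N \notin E].

(* Only meaningful on nonempty sets; where the convention [min fset0 = +oo]
   matters, use [fle] below. *)
Definition fmin (E : {fset nat}) : nat := head 0%N (sort leq E).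

(* [m <= min E], true when [E] is empty. *)
Definition fle (m : nat) (E : {fset nat}) : Prop :=
  forall a, a \in E -> (m <= a)%N.

(* [A < B], true when [A] or [B] is empty. *)
Definition flt (A B : {fset nat}) : Prop :=
  forall a b, a \in A -> b \in B -> (a < b)%N.

Definition successive k (E : 'I_k -> {fset nat}) : Prop :=
  forall i j : 'I_k, (i < j)%N -> flt (E i) (E j).

Definition funion k (E : 'I_k -> {fset nat}) : {fset nat} :=
  \big[fsetU/fset0]_(i < k) E i.

Definition set_of_mins k (E : 'I_k -> {fset nat}) : {fset nat} :=
  [fset fmin (E i) | i in 'I_k]%fset.

Definition admissible (F : set {fset nat}) k (E : 'I_k -> {fset nat}) : Prop :=
  [/\ forall i, E i != fset0 /\ posset (E i),
      successive E & F (set_of_mins E)].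

Definition allowable (F : set {fset nat}) k (E : 'I_k -> {fset nat}) : Prop :=
  [/\ forall i, E i != fset0 /\ posset (E i),
      forall i j, i != j -> [disjoint E i & E j]%fset & F (set_of_mins E)].

(* [M[N]] *)
Definition set_compose (M N : set {fset nat}) : set {fset nat} :=
  [set A | exists k (E : 'I_k -> {fset nat}),
    [/\ admissible M E, forall i, N (E i) & A = funion E]].

(* [A_n] *)
Definition card_le_family (n : nat) : set {fset nat} :=
  [set E | posset E /\ (#|` E| <= n)%N].

Section Ordinals.
Local Open Scope order_scope.
Context {d : Order.disp_t} {W : orderType d}.

(* A well-order is isomorphic to the first uncountable ordinal iff it is
   uncountable and all its proper initial segments are countable. *)
Definition is_omega1 : Prop :=
  [/\ well_founded (fun a b : W => a < b),
      forall a : W, countable [set b : W | b < a]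
    & ~ countable [set: W]].

Definition is_zero (a : W) : Prop := forall b : W, a <= b.

(* [b = a + 1] *)
Definition is_succ (a b : W) : Prop :=
  a < b /\ forall c : W, c < b -> c <= a.

Definition is_limit (a : W) : Prop :=
  ~ is_zero a /\ forall b : W, ~ is_succ b a.

(* Since every element is exactly one of zero, a successor (of a unique
   element) or a limit, and since [alpha xi n < xi] for [xi] limit (see
   [fundamental] below), this inductive predicate is the family defined by the
   usual transfinite recursion. *)
Inductive schreier (alpha : W -> nat -> W) : W -> {fset nat} -> Prop :=
| schreier_zero0 xi :
    is_zero xi -> schreier alpha xi fset0
| schreier_zero1 xi n :
    is_zero xi -> (0 < n)%N -> schreier alpha xi [fset n]%fset
| schreier_succ0 g xi :
    is_succ g xi -> schreier alpha xi fset0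
| schreier_succ g xi n (E : 'I_n -> {fset nat}) :
    is_succ g xi -> (0 < n)%N ->
    (forall i, E i != fset0) -> (forall i, schreier alpha g (E i)) ->
    (forall i, fle n (E i)) -> successive E ->
    schreier alpha xi (funion E)
| schreier_limit xi n E :
    is_limit xi -> (0 < n)%N -> fle n E ->
    schreier alpha (alpha xi n) E -> schreier alpha xi E.

(* [alpha xi n] is only meaningful for [xi] limit and [n >= 1]. *)
Record fundamental (alpha : W -> nat -> W) : Prop := Fundamental {
  fundamental_succ : forall xi n, is_limit xi -> (0 < n)%N ->
    exists g, is_succ g (alpha xi n);
  fundamental_lt : forall xi n, is_limit xi -> (0 < n)%N ->
    alpha xi n < xi;
  fundamental_incr : forall xi m n, is_limit xi -> (0 < m)%N -> (m < n)%N ->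
    alpha xi m < alpha xi n;
  fundamental_sup : forall xi b, is_limit xi -> b < xi ->
    exists2 n, (0 < n)%N & b < alpha xi n;
  fundamental_first : forall xi, is_limit xi ->
    exists2 z, is_zero z & is_succ z (alpha xi 1%N);
  fundamental_union : forall xi n (A B : {fset nat}),
    is_limit xi -> (0 < n)%N ->
    schreier alpha (alpha xi n) A -> schreier alpha (alpha xi n) B ->
    fle 2 A -> flt A B ->
    schreier alpha (alpha xi n.+1) (A `|` B)%fset }.

End Ordinals.

Arguments is_omega1 {d} W.

Section Norms.
Context {R : realType}.

Definition c00 : set (nat -> R) :=
  [set x | x 0%N = 0 /\ finite_set [set n | x n != 0]].

Definition coord_restrict (E : {fset nat}) (x : nat -> R) : nat -> R :=
  fun n => if n \in E then x n else 0.

Record norm_on_c00 (N : (nat -> R) -> R) : Prop := NormOnC00 {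
  norm_c00_eq0 : forall x, c00 x -> N x = 0 -> x = (fun=> 0);
  norm_c00Z : forall (a : R) x, c00 x -> N (fun n => a * x n) = `|a| * N x;
  norm_c00D : forall x y, c00 x -> c00 y ->
    N (fun n => x n + y n) <= N x + N y }.

(* The implicit equation is stated in [\bar R], where suprema are always
   meaningful. *)
Definition implicit_norm (adm : forall k, ('I_k -> {fset nat}) -> Prop)
    (theta : R) (N : (nat -> R) -> R) : Prop :=
  norm_on_c00 N /\
  forall x, c00 x ->
    (N x)%:E = maxe (ereal_sup (range (fun n => `|x n|%:E)))
      (theta%:E * ereal_sup [set s | exists k (E : 'I_k -> {fset nat}),
         adm k E /\ s = (\sum_(i < k) N (coord_restrict (E i) x))%:E])%E.

(* For every family [F] and [0 < theta < 1], each of the next two predicates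
   is satisfied by a norm that is unique on [c00]: the equation determines
   [N x] by induction on the size of the support of [x]. *)
Definition tsirelson_norm (F : set {fset nat}) :=
  implicit_norm (@admissible F).

Definition modified_tsirelson_norm (F : set {fset nat}) :=
  implicit_norm (@allowable F).

End Norms.

(* Main.v *)
(** Both norms are suprema of the sums [\sum_(n in A) theta ^ h n * |x n|] over
    the trees of decompositions with set of leaves [A], the leaf [n] having
    depth [h n]; so it is enough to rearrange trees of allowable decompositions
    into trees of successive ones without increasing the depth of any leaf.

    For the first inequality, consider the first two generations of an allowable
    tree, with minima [m_1 < ... < m_k] in the first one, and cut the line
    greedily, so that between two cuts the minima of the pieces of the second
    generation form a member of [S_xi]; what lies between two cuts is then one
    allowable piece, one level higher. A cut is also needed at each leaf of
    depth one and just after it. After two cuts of the greedy kind there is room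
    for the pieces coming from one more [m_i] ([schreier_union]), hence every
    other cut can be charged to a different [m_i] lying before it, and the cuts
    form a member of [S_xi[A_2]]. Then induct on the depth.

    For the factor 3, every member of [S_xi[A_6]] is, for [xi > 0], the union of
    three successive members of [S_xi]; by induction on the depth, a successive
    tree for [S_xi[A_2]] therefore splits into three successive trees for
    [S_xi]. For [xi = 0] allowable and admissible mean the same. *)
Require Import Defs.
From mathcomp Require Import all_boot all_order all_algebra finmap.
From mathcomp Require Import all_classical all_reals ereal.
From mathcomp Require Import zify.

Set Implicit Arguments.
Unset Strict Implicit.
Unset Printing Implicit Defensive.

Import Order.TTheory GRing.Theory Num.Theory.

Local Open Scope ring_scope.

(** * Finite sets of integers *)

Definition below (A : {fset nat}) t := [fset a in A | (a < t)%N]%fset.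
Definition above (A : {fset nat}) t := [fset a in A | (t <= a)%N]%fset.

Lemma in_below (A : {fset nat}) t a : (a \in below A t) = (a \in A) && (a < t)%N.
Proof. by rewrite !inE. Qed.

Lemma in_above (A : {fset nat}) t a : (a \in above A t) = (a \in A) && (t <= a)%N.
Proof. by rewrite !inE. Qed.

Ltac fset_lia :=
  rewrite ?(in_below, in_above, inE);
  repeat match goal with |- context [?a \in ?X] => case: (a \in X) end => //=;
  lia.

Section FiniteSets.
Local Open Scope fset_scope.
Local Open Scope nat_scope.
Implicit Types (A B C D X Y : {fset nat}) (F : {fset nat} -> Prop).

Lemma below_sub A t : below A t `<=` A.
Proof. by apply/fsubsetP => a; rewrite in_below => /andP[]. Qed.

Lemma above_sub A t : above A t `<=` A.
Proof. by apply/fsubsetP => a; rewrite in_above => /andP[]. Qed.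

Lemma below_mono A B t : A `<=` B -> below A t `<=` below B t.
Proof.
move=> /fsubsetP AB; apply/fsubsetP => a; rewrite !in_below => /andP[/AB -> ->].
by [].
Qed.

Lemma below_below A s t : below (below A s) t = below A (minn s t).
Proof. by apply/fsetP => a; fset_lia. Qed.

Lemma above_above A s t : above (above A s) t = above A (maxn s t).
Proof. by apply/fsetP => a; fset_lia. Qed.

Lemma belowU A B t : below (A `|` B) t = below A t `|` below B t.
Proof. by apply/fsetP => a; fset_lia. Qed.

Lemma aboveU A B t : above (A `|` B) t = above A t `|` above B t.
Proof. by apply/fsetP => a; fset_lia. Qed.

Lemma card_below_above A s t :
  s <= t -> #|` below A t| = #|` below A s| + #|` below (above A s) t|.
Proof.
move=> st; rewrite -cardfsUI.
have -> : below A s `&` below (above A s) t = fset0.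
  by apply/fsetP => a; fset_lia.
rewrite cardfs0 addn0; congr (#|` _|).
by apply/fsetP => a; fset_lia.
Qed.

Lemma below_all A : exists t, below A t = A.
Proof.
exists (\max_(a <- A) a).+1; apply/fsetP => a; rewrite in_below.
by case: (boolP (a \in A)) => //= aA; rewrite ltnS (leq_bigmax_seq a).
Qed.

Lemma card_below A t : #|` below A t| <= #|` A|.
Proof. exact/fsubset_leq_card/below_sub. Qed.

(* [p = 1] bundles heredity and spreading: [C] is obtained from a subset of
   [A] by moving elements to the right. *)
Definition dom p C A := forall t, #|` below C t| <= p * #|` below A t|.

Lemma dom_card p C A : dom p C A -> #|` C| <= p * #|` A|.
Proof.
move=> CA; have [t Ct] := below_all C.
rewrite -{1}Ct; apply: leq_trans (CA t) _.
by rewrite leq_mul2l card_below orbT.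
Qed.

Lemma dom_trans p q A B C : dom p C B -> dom q B A -> dom (p * q) C A.
Proof.
move=> CB BA t; apply: leq_trans (CB t) _.
by rewrite -mulnA leq_mul2l BA orbT.
Qed.

Lemma dom_sub A B C : B `<=` C -> dom 1 C A -> dom 1 B A.
Proof.
move=> BC CA t; apply: leq_trans (CA t).
exact/fsubset_leq_card/below_mono.
Qed.

Lemma dom_refl A : dom 1 A A.
Proof. by move=> t; rewrite mul1n. Qed.

Lemma sub_dom A B : A `<=` B -> dom 1 A B.
Proof. by move=> AB; apply: (dom_sub AB); apply: dom_refl. Qed.

(** Below each [t], the pairs [(phi c, q c)] are distinct, and [phi c] lies in [below A t] because
    [phi] moves points to the left. *)
Lemma dom_inj_mul k q (phi : nat -> nat) C A :
  {in C &, injective (fun c => (phi c, q c))} -> (forall c, c \in C -> q c < k) ->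
  (forall c, c \in C -> phi c \in A) -> (forall c, c \in C -> phi c <= c) ->
  dom k C A.
Proof.
move=> inj qk phiA phile t.
rewrite -[leqLHS](size_map (fun c => (phi c, q c))).
have -> : k * #|` below A t| = size [seq (a, i) | a <- below A t, i <- iota 0 k].
  by rewrite size_allpairs size_iota mulnC.
apply: uniq_leq_size.
  rewrite map_inj_in_uniq ?fset_uniq // => a b.
  by rewrite !in_below => /andP[aC _] /andP[bC _]; apply: inj.
move=> _ /mapP[c + ->]; rewrite in_below => /andP[cC ct].
apply: allpairs_f; last by rewrite mem_iota add0n qk.
by rewrite in_below phiA //=; apply: leq_ltn_trans ct; apply: phile.
Qed.

Lemma dom_inj (phi : nat -> nat) C A :
  {in C &, injective phi} -> (forall c, c \in C -> phi c \in A) ->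
  (forall c, c \in C -> phi c <= c) -> dom 1 C A.
Proof.
move=> inj; apply: (@dom_inj_mul 1 (fun=> 0)) => // a b aC bC [].
exact: inj.
Qed.

Lemma dom_fle n p C A : dom p C A -> fle n A -> fle n C.
Proof.
move=> CA nA c cC; rewrite leqNgt; apply/negP => cn.
have := CA n; have -> : below A n = fset0.
  by apply/fsetP => a; rewrite !inE; apply/negP => /andP[/nA]; lia.
rewrite cardfs0 muln0 leqn0 cardfs_eq0 => /eqP/fsetP/(_ c).
by rewrite !inE cC cn.
Qed.

Lemma posset_fle A : posset A <-> fle 1 A.
Proof.
split=> [A0 a aA|A1]; first by rewrite lt0n; apply: contra A0 => /eqP <-.
by apply/negP => /A1.
Qed.

Lemma dom_posset p C A : dom p C A -> posset A -> posset C.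
Proof. by rewrite !posset_fle; apply: dom_fle. Qed.

Lemma fle_sub n A B : A `<=` B -> fle n B -> fle n A.
Proof. by move=> /fsubsetP AB nB a /AB /nB. Qed.

Lemma posset_sub A B : A `<=` B -> posset B -> posset A.
Proof. by rewrite !posset_fle; apply: fle_sub. Qed.

Lemma fle_above n A : fle n (above A n).
Proof. by move=> a; rewrite in_above => /andP[]. Qed.

Lemma fle_leq m n A : m <= n -> fle n A -> fle m A.
Proof. by move=> mn nA a /nA; apply: leq_trans. Qed.

Lemma fle_aboveE n A : fle n A -> above A n = A.
Proof.
move=> nA; apply/fsetP => a; rewrite in_above.
by case: (boolP (a \in A)) => // /nA ->.
Qed.

(** Moving the threshold by one adds at most one element, so the least [t] with at least [m]
    elements below it has exactly [m]. The second alternative is for sets with fewer than [m]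
    elements. *)
Lemma cut_card C m :
  exists t, #|` below C t| = m \/ #|` below C t| <= m /\ above C t = fset0.
Proof.
case: (leqP m #|` C|) => [mC|Cm]; last first.
  have [t Ct] := below_all C; exists t; right; split.
    by rewrite Ct ltnW.
  apply/fsetP => a; rewrite !inE; apply/negP => /andP[aC ta].
  by move: aC; rewrite -Ct in_below; lia.
have ext : exists t, m <= #|` below C t|.
  by have [t Ct] := below_all C; exists t; rewrite Ct.
exists (ex_minn ext); left; case: ex_minnP => t tm tmin.
apply/eqP; rewrite eqn_leq tm andbT leqNgt; apply/negP => mt.
case: t => [|t] in tm tmin mt *.
  move: mt; rewrite (_ : below C 0 = fset0) ?cardfs0 //.
  by apply/fsetP => a; rewrite !inE andbF.
suff /tmin : m <= #|` below C t| by rewrite ltnn.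
have := card_below_above C (leqnSn t).
suff : #|` below (above C t) t.+1| <= #|` [fset t]| by rewrite cardfs1; lia.
by apply: fsubset_leq_card; apply/fsubsetP => a; fset_lia.
Qed.

(** The cut [s] comes after the first [p * k] elements of [C], where [k] counts [A] below [t], or
    after all of [C]. The left part then obeys the bound even past [t]; subtracting [p * k] gives
    the bound for the right part. *)
Lemma dom_split p C A t : dom p C A ->
  exists s, dom p (below C s) (below A t) /\ dom p (above C s) (above A t).
Proof.
move=> CA; have [s hs] := cut_card C (p * #|` below A t|); exists s.
split=> u.
  rewrite below_below [below (below A t) u]below_below.
  case: (leqP t u) => tu.
    apply: leq_trans (_ : _ <= #|` below C s|) _; last by case: hs => [->|[]].
    by rewrite -below_below card_below.
  apply: leq_trans (CA u).
  by rewrite minnC -below_below card_below.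
case: hs => [hs|[_ ->]]; last first.
  by rewrite (_ : below fset0 u = fset0) ?cardfs0 //; apply/fsetP => a; rewrite !inE.
case: (leqP s u) => su; last first.
  rewrite (_ : below (above C s) u = fset0) ?cardfs0 //.
  by apply/fsetP => a; fset_lia.
have := card_below_above C su; have := CA u.
case: (leqP t u) => tu.
  by rewrite (card_below_above A tu) mulnDr hs; lia.
rewrite hs.
have : #|` below A u| <= #|` below A t|.
  by rewrite -(minn_idPr (ltnW tu)) -below_below card_below.
by move: #|` below A u| #|` below A t| => a b ab; nia.
Qed.

(** * Concatenations of successive members of a family *)

Definition dom_closed F := forall C A, dom 1 C A -> F A -> F C.

Lemma dom_closed_sub F A B : dom_closed F -> A `<=` B -> F B -> F A.
Proof. by move=> Fd AB; apply: Fd; apply: sub_dom. Qed.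

Lemma dom_closed0 F A : dom_closed F -> F A -> F fset0.
Proof. by move=> Fd; apply: dom_closed_sub. Qed.

(** Unions of [n] successive, possibly empty, members of [F]. Thresholds instead of an indexed
    family reduce cutting, restricting and concatenating to [below] and [above]. *)
Fixpoint nfold F n X : Prop :=
  if n is m.+1 then exists t, F (below X t) /\ nfold F m (above X t)
  else X = fset0.

Lemma nfold_dom F n C A :
  dom_closed F -> dom 1 C A -> nfold F n A -> nfold F n C.
Proof.
move=> Fd; elim: n C A => [|n IH] C A CA /=.
  move=> A0; apply/eqP; rewrite -cardfs_eq0 -leqn0.
  by apply: leq_trans (dom_card CA) _; rewrite A0 cardfs0.
case=> t [FA nA]; have [s [d1 d2]] := dom_split t CA.
by exists s; split; [apply: Fd d1 FA|apply: IH d2 nA].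
Qed.

Lemma nfold_sub F n A B :
  dom_closed F -> A `<=` B -> nfold F n B -> nfold F n A.
Proof. by move=> Fd AB; apply: nfold_dom => //; apply: sub_dom. Qed.

Lemma nfold0 F n : F fset0 -> nfold F n fset0.
Proof.
move=> F0; elim: n => //= n IH; exists 0.
have -> : below fset0 0 = fset0 by apply/fsetP => a; rewrite !inE.
by have -> : above fset0 0 = fset0 by apply/fsetP => a; rewrite !inE.
Qed.

Lemma nfold_leq F m n X : F fset0 -> m <= n -> nfold F m X -> nfold F n X.
Proof.
move=> F0; elim: m n X => [|m IH] n X; first by move=> _ ->; apply: nfold0.
by case: n => // n mn [t [FX nX]]; exists t; split=> //; apply: IH.
Qed.

Lemma nfold_cat F m n X t : dom_closed F ->
  nfold F m (below X t) -> nfold F n (above X t) -> nfold F (m + n) X.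
Proof.
move=> Fd; elim: m X => [|m IH] X.
  move=> X0 nX; rewrite add0n; suff -> : X = above X t by [].
  apply/fsetP => a; move/fsetP: X0 => /(_ a); rewrite !inE.
  by case: (a \in X) => //=; lia.
(* The first cut of [below X t] may lie beyond [t], where it would pick up points of [above X t];
   the minimum prevents this. *)
case=> s [FX nX] nY; exists (minn s t); split.
  by move: FX; rewrite below_below minnC.
have -> : above X (minn s t) = above (below X t) s `|` above X t.
  by apply/fsetP => a; fset_lia.
apply: IH.
  rewrite (_ : below _ _ = above (below X t) s) //.
  by apply/fsetP => a; fset_lia.
rewrite (_ : above _ _ = above X t) //.
by apply/fsetP => a; fset_lia.
Qed.

Lemma nfold1 F X : F fset0 -> F X -> nfold F 1 X.
Proof.
move=> F0 FX; have [t Xt] := below_all X; exists t; rewrite Xt; split=> //=.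
apply/fsetP => a; move/fsetP: Xt => /(_ a); rewrite !inE.
by case: (a \in X) => //=; lia.
Qed.

Lemma nfold1E F X : nfold F 1 X -> F X.
Proof.
case=> t [+ X0]; rewrite (_ : below X t = X) //.
apply/fsetP => a; move/fsetP: X0 => /(_ a); rewrite !inE.
by case: (a \in X) => //=; lia.
Qed.

Definition merging F M := forall X Y, F X -> F Y -> nfold F M (X `|` Y).

(** Cut both sets at the smaller first cut [s]. Below [s] there are a member of [F] and part of
    another one, which give [M] pieces; beyond [s] one of the two sets has lost a piece, so [m + n]
    decreases. *)
Lemma nfold_merge F M m n X Y : dom_closed F -> merging F M ->
  nfold F m X -> nfold F n Y -> nfold F (M * (m + n)) (X `|` Y).
Proof.
move=> Fd FM; have [k] := ubnP (m + n).
elim: k m n X Y => // k IH [|m] [|n] X Y mnk.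
- by move=> /= -> ->; rewrite fsetU0 muln0.
- move=> /= -> nY; rewrite fset0U.
  have [t [FY nY']] := nY.
  rewrite add0n mulnS; apply: (@nfold_cat _ _ _ _ t) => //.
    by rewrite -[below Y t]fsetUid; apply: FM.
  by have := IH 0 n fset0 (above Y t); rewrite fset0U; apply => //=; lia.
- move=> nX /= ->; rewrite fsetU0.
  have [t [FX nX']] := nX.
  rewrite addn0 mulnS; apply: (@nfold_cat _ _ _ _ t) => //.
    by rewrite -[below X t]fsetUid; apply: FM.
  by have := IH m 0 (above X t) fset0; rewrite fsetU0 addn0; apply => //=; lia.
wlog: m n X Y mnk / exists s t, [/\ s <= t, F (below X s), nfold F m (above X s),
   F (below Y t) & nfold F n (above Y t)].
  move=> wl nX nY; have [s [FX mX]] := nX; have [t [FY mY]] := nY.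
  case: (leqP s t) => st; first by apply: wl => //; exists s, t.
  rewrite fsetUC addnC; apply: wl => //; first by rewrite addnC.
  by exists t, s; split=> //; apply: ltnW.
move=> [s [t [st FX mX FY mY]]] _ nY.
rewrite addSn mulnS; apply: (@nfold_cat _ _ _ _ s) => //.
  rewrite belowU; apply: FM => //.
  apply: dom_closed_sub FY => //.
  by rewrite -(minn_idPr st) -below_below below_sub.
rewrite aboveU; apply: IH => //; apply: nfold_sub nY => //; exact: above_sub.
Qed.

End FiniteSets.

(** * Schreier families *)

Section Schreier.
Local Open Scope fset_scope.
Local Open Scope nat_scope.
Context {d : Order.disp_t} {W : orderType d} (alpha : W -> nat -> W).
Implicit Types (A B C D E X Y : {fset nat}) (xi g z : W).

Local Notation S := (schreier alpha).

Lemma flt_cut A B : flt A B ->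
  exists t, (forall a, a \in A -> a < t) /\ fle t B.
Proof.
move=> AB; exists (\max_(a <- A) a.+1); split=> [a aA|b bB].
  exact: (@leq_bigmax_seq _ _ _ succn).
by apply/bigmax_leqP_seq => a aA _; apply: AB.
Qed.

Lemma in_funion k (E : 'I_k -> {fset nat}) a :
  reflect (exists i, a \in E i) (a \in funion E).
Proof.
apply: (iffP (bigfcupP _ _ _ _)) => [[i _ ai]|[i ai]]; first by exists i.
by exists i => //; rewrite mem_index_enum.
Qed.

Lemma nfold_funion (F : {fset nat} -> Prop) n (E : 'I_n -> {fset nat}) :
  (forall i, F (E i)) -> successive E -> nfold F n (funion E).
Proof.
elim: n E => [|n IH] E FE Es /=; first by rewrite /funion big_ord0.
have -> : funion E = E ord0 `|` funion (fun i => E (lift ord0 i)).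
  by rewrite /funion big_ord_recl.
have [t [Et tE]] : exists t, (forall a, a \in E ord0 -> a < t) /\
    fle t (funion (fun i => E (lift ord0 i))).
  by apply: flt_cut => a b a0 /in_funion[i bi]; apply: (Es ord0 (lift ord0 i)).
exists t; split.
  rewrite (_ : below _ _ = E ord0) //; apply/fsetP => a.
  rewrite in_below in_fsetU; case: (boolP (a \in E ord0)) => [/Et ->//|_] /=.
  by apply/negP => /andP[/tE]; lia.
rewrite (_ : above _ _ = funion (fun i => E (lift ord0 i))).
  by apply: IH => [i|i j ij]; [apply: FE|apply: Es].
apply/fsetP => a; rewrite in_above in_fsetU.
case: (boolP (a \in funion _)) => [/tE ->|_]; first by rewrite orbT.
by rewrite orbF; apply/negP => /andP[/Et]; lia.
Qed.

(** Empty pieces are discarded, whence only [m <= n]. *)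
Lemma nfold_family (F : {fset nat} -> Prop) n X : nfold F n X ->
  exists m (E : 'I_m -> {fset nat}), [/\ m <= n, forall i, E i != fset0,
    forall i, F (E i), successive E & X = funion E].
Proof.
elim: n X => [|n IH] X /= => [->|[t [FX /IH[m [E [mn E0 FE Es XE]]]]]].
  by exists 0, (fun=> fset0); split=> [|[]|[]|[]|] //; rewrite /funion big_ord0.
have XU : X = below X t `|` above X t by apply/fsetP => a; fset_lia.
case: (eqVneq (below X t) fset0) => [X0|X0].
  exists m, E; split=> //; first exact: ltnW.
  by rewrite -XE {1}XU X0 fset0U.
exists m.+1, (fun i => if unlift ord0 i is Some j then E j else below X t).
split=> //.
- by move=> i; case: (unlift ord0 i).
- by move=> i; case: (unlift ord0 i).
- move=> i j /=; case: (unliftP ord0 i) => [i' ->|->];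
    case: (unliftP ord0 j) => [j' ->|->] //.
    exact: (Es i' j').
  move=> _ a b; rewrite in_below => /andP[_ at_] bj.
  have : b \in above X t by rewrite XE; apply/in_funion; exists j'.
  by rewrite in_above => /andP[_]; apply: leq_trans.
- rewrite /funion big_ord_recl unlift_none {1}XU XE; congr (_ `|` _).
  by apply: eq_bigr => i _; rewrite liftK.
Qed.

Lemma nfold_card_le (F : {fset nat} -> Prop) n X :
  (forall Y, F Y -> #|` Y| <= 1) -> nfold F n X -> #|` X| <= n.
Proof.
move=> F1; elim: n X => [|n IH] X /=; first by move=> ->; rewrite cardfs0.
case=> t [/F1 b1 /IH an].
have -> : X = below X t `|` above X t by apply/fsetP => a; fset_lia.
by rewrite cardfsU; lia.
Qed.

Lemma card_nfold (F : {fset nat} -> Prop) n X :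
  (forall Y, posset Y -> #|` Y| <= 1 -> F Y) -> posset X -> #|` X| <= n ->
  nfold F n X.
Proof.
move=> F1; elim: n X => [|n IH] X Xp.
  by rewrite leqn0 cardfs_eq0 => /eqP.
move=> Xn; have [t ht] := cut_card X 1; exists t; split.
  apply: F1; last by case: ht => [->|[]].
  by apply: posset_sub Xp; apply: below_sub.
apply: IH; first by apply: posset_sub Xp; apply: above_sub.
case: ht => [b1|[_ ->]]; last by rewrite cardfs0.
have XU : X = below X t `|` above X t by apply/fsetP => a; fset_lia.
have I0 : below X t `&` above X t = fset0 by apply/fsetP => a; fset_lia.
by move: Xn; rewrite {1}XU cardfsU I0 cardfs0 b1; lia.
Qed.

Lemma nfold_mul (F : {fset nat} -> Prop) p k n C A : dom_closed F ->
  (forall C A, dom p C A -> F A -> nfold F k C) ->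
  dom p C A -> nfold F n A -> nfold F (n * k) C.
Proof.
move=> Fd Fk; elim: n C A => [|n IH] C A CA /=.
  move=> A0; apply/eqP; rewrite -cardfs_eq0 -leqn0.
  by apply: leq_trans (dom_card CA) _; rewrite A0 cardfs0 muln0.
case=> t [FA nA]; have [s [d1 d2]] := dom_split t CA.
by rewrite mulSn; apply: (@nfold_cat _ _ _ _ s) => //; [apply: Fk d1 FA|apply: IH d2 nA].
Qed.

Lemma ord_case xi : is_zero xi \/ (exists g, is_succ g xi) \/ is_limit xi.
Proof.
have [z|nz] := EM (is_zero xi); first by left.
have [s|ns] := EM (exists g, is_succ g xi); first by right; left.
by right; right; split=> // g sg; apply: ns; exists g.
Qed.

Lemma zero_not_succ g xi : is_zero xi -> ~ is_succ g xi.
Proof. by move=> /(_ g) xg [gx _]; have := le_lt_trans xg gx; rewrite ltxx. Qed.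

Lemma succ_inj g g' xi : is_succ g xi -> is_succ g' xi -> g = g'.
Proof. by move=> [a b] [a' b']; apply: le_anti; rewrite b' // b. Qed.

Lemma schreier_zeroP xi X : is_zero xi ->
  S xi X <-> X = fset0 \/ exists2 n, 0 < n & X = [fset n].
Proof.
move=> xi0; split=> [SX|[->|[n n0 ->]]]; last 2 first.
- exact: schreier_zero0.
- exact: schreier_zero1.
case: SX xi0 => {xi X}.
- by move=> xi _ _; left.
- by move=> xi n _ n0 _; right; exists n.
- by move=> g xi s /zero_not_succ/(_ s).
- by move=> g xi n E s _ _ _ _ _ /zero_not_succ/(_ s).
- by move=> xi n E [].
Qed.

(** Allowing empty pieces changes nothing: [n <= min X] implies the same inequality for the number
    of nonempty pieces. *)
Lemma schreier_succP g xi X : is_succ g xi ->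
  S xi X <-> X = fset0 \/ exists n, [/\ 0 < n, fle n X & nfold (S g) n X].
Proof.
move=> gxi; split=> [SX|].
  case: SX gxi => {xi X}.
  - by move=> xi _ _; left.
  - by move=> xi n z _ /(zero_not_succ z).
  - by move=> g' xi _ _; left.
  - move=> g' xi n E s n0 _ SE nE Es /(succ_inj s) <-.
    right; exists n; split=> //; last exact: nfold_funion.
    by move=> a /in_funion[i]; apply: nE.
  - by move=> xi n E [_ ns] _ _ _ s; case: (ns _ s).
case=> [->|[n [n0 nX /nfold_family[m [E [mn E0 SE Es XE]]]]]].
  exact: schreier_succ0 gxi.
rewrite XE; case: (posnP m) => [m0|m0].
  rewrite (_ : funion E = fset0); first exact: schreier_succ0 gxi.
  apply/fsetP => a; rewrite in_fset0; apply/negP => /in_funion[[i im] _].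
  by rewrite m0 in im.
apply: (schreier_succ gxi) => // i a ai; apply: leq_trans mn _.
by apply: nX; rewrite XE; apply/in_funion; exists i.
Qed.

Lemma schreier_limitP xi X : is_limit xi ->
  S xi X <-> exists n, [/\ 0 < n, fle n X & S (alpha xi n) X].
Proof.
move=> lxi; split=> [SX|[n [n0 nX SX]]]; last exact: schreier_limit SX.
case: SX lxi => {xi X}.
- by move=> xi z [].
- by move=> xi n z _ [].
- by move=> g xi s [_ /(_ _ s)].
- by move=> g xi n E s _ _ _ _ _ [_ /(_ _ s)].
- by move=> xi n E _ n0 nE SE _; exists n.
Qed.

(** * Closure properties of the Schreier families *)

Definition is_one xi := exists2 z, is_zero z & is_succ z xi.

Hypothesis wfW : well_founded (fun a b : W => (a < b)%O).
Hypothesis alphaP : fundamental alpha.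

Lemma schreier0 xi : S xi fset0.
Proof.
case: (ord_case xi) => [z|[[g s]|l]].
- exact: schreier_zero0.
- exact: schreier_succ0 s.
- apply/(schreier_limitP _ l); exists 1; split=> //.
  by have [z _ s] := fundamental_first alphaP l; exact: schreier_succ0 s.
Qed.

Lemma schreier_posset xi X : S xi X -> posset X.
Proof.
case: (ord_case xi) => [z|[[g s]|l]].
- case/(schreier_zeroP _ z) => [->//|[n n0 ->]].
  by rewrite /posset /= inE; lia.
- case/(schreier_succP _ s) => [->//|[n [n0 nX _]]].
  by apply/posset_fle; apply: fle_leq nX.
- case/(schreier_limitP _ l) => n [n0 nX _].
  by apply/posset_fle; apply: fle_leq nX.
Qed.

Lemma schreier_zero_card xi X : is_zero xi ->
  S xi X <-> posset X /\ #|` X| <= 1.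
Proof.
move=> z; split=> [SX|[Xp X1]].
  split; first exact: schreier_posset SX.
  by case/(schreier_zeroP _ z): SX => [->|[n _ ->]]; rewrite ?cardfs0 ?cardfs1.
apply/(schreier_zeroP _ z).
have [->|/fset0Pn[n nX]] := eqVneq X fset0; first by left.
right; exists n; first by move/posset_fle: Xp; apply.
apply/eqP; rewrite eq_sym eqEfcard cardfs1 X1 andbT.
by apply/fsubsetP => a; rewrite inE => /eqP ->.
Qed.

(** The Schreier families are hereditary and spreading. In the successor step, [C] is distributed
    over the pieces of [A]. *)
Lemma schreier_dom_closed xi : dom_closed (S xi).
Proof.
elim/(well_founded_ind wfW): xi => xi IH C A CA.
case: (ord_case xi) => [z|[[g s]|l]].
- rewrite !schreier_zero_card // => -[Ap A1]; split; first exact: dom_posset Ap.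
  by apply: leq_trans (dom_card CA) _; rewrite mul1n.
- case/(schreier_succP _ s) => [A0|[n [n0 nA fA]]]; apply/(schreier_succP _ s).
    left; apply/eqP; rewrite -cardfs_eq0 -leqn0.
    by apply: leq_trans (dom_card CA) _; rewrite A0 cardfs0.
  right; exists n; split=> //; first exact: dom_fle nA.
  by apply: nfold_dom fA => //; apply: IH; case: s.
- case/(schreier_limitP _ l) => n [n0 nA fA]; apply/(schreier_limitP _ l).
  exists n; split=> //; first exact: dom_fle nA.
  by apply: IH fA => //; apply: fundamental_lt.
Qed.

(** The classical Schreier family: the pieces are singletons, so their number is the cardinality. *)
Lemma schreier_oneP xi X : is_one xi -> S xi X <-> posset X /\ fle #|` X| X.
Proof.
case=> z z0 s; split=> [SX|[Xp X1]].
  split; first exact: schreier_posset SX.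
  case/(schreier_succP _ s): SX => [->//|[n [n0 nX fX]]].
  apply: fle_leq nX; apply: nfold_card_le fX => Y.
  by rewrite schreier_zero_card // => -[].
apply/(schreier_succP _ s).
have [->|X0] := eqVneq X fset0; first by left.
right; exists #|` X|; split=> //; first by rewrite cardfs_gt0.
by apply: card_nfold => // Y Yp Y1; rewrite schreier_zero_card.
Qed.

Lemma succ_sub g xi X : is_succ g xi -> S g X -> S xi X.
Proof.
move=> s SX; apply/(schreier_succP _ s); right; exists 1; split=> //.
  by apply/posset_fle; apply: schreier_posset SX.
by apply: nfold1 => //; apply: schreier0.
Qed.

(** This is the inclusion of [S_1] in [S_xi]; at a limit it comes from [alpha xi 1 = 1]. *)
Lemma schreier_card xi X : ~ is_zero xi -> posset X -> fle #|` X| X -> S xi X.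
Proof.
move=> + Xp X1; elim/(well_founded_ind wfW): xi => xi IH nz.
case: (ord_case xi) => [//|[[g s]|l]].
- have [z|z] := EM (is_zero g).
    by rewrite schreier_oneP //; exists g.
  by apply: (succ_sub s); apply: IH => //; case: s.
- apply/(schreier_limitP _ l); exists 1; split=> //; first exact/posset_fle.
  by rewrite schreier_oneP //; apply: fundamental_first.
Qed.

(** With minimum 1 only [n = 1] is available, so no proper union is ever formed and the set descends
    to [S_0]. *)
Lemma schreier_has1 xi X : S xi X -> 1 \in X -> #|` X| <= 1.
Proof.
elim/(well_founded_ind wfW): xi => xi IH SX X1.
case: (ord_case xi) => [z|[[g s]|l]].
- by move: SX; rewrite schreier_zero_card // => -[].
- case/(schreier_succP _ s): SX => [->|[n [n0 nX fX]]]; first by rewrite cardfs0.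
  have n1 : n = 1 by have := nX _ X1; lia.
  by rewrite n1 in fX; apply: IH (nfold1E fX) X1; case: s.
- case/(schreier_limitP _ l): SX => n [n0 nX fX].
  by apply: IH fX X1; apply: fundamental_lt.
Qed.

Lemma alpha_not_zero xi n : is_limit xi -> 0 < n -> ~ is_zero (alpha xi n).
Proof.
move=> l n0; have [g s] := fundamental_succ alphaP l n0.
by move=> /zero_not_succ/(_ s).
Qed.

(** The union property of the fundamental sequence, applied with an empty second set. *)
Lemma alpha_mono xi m n X : is_limit xi -> 0 < m -> m <= n -> fle 2 X ->
  S (alpha xi m) X -> S (alpha xi n) X.
Proof.
move=> l m0 + X2 SX; elim: n => [|n IH]; first by case: m m0 SX.
rewrite leq_eqVlt => /orP[/eqP <-//|]; rewrite ltnS => mn.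
rewrite -[X]fsetU0; apply: fundamental_union => //.
- exact: leq_trans mn.
- exact: IH.
- exact: schreier0.
Qed.

(** * Long intervals and interleaved unions in the Schreier families *)

Definition seg b c := [fset a in iota b (c - b)].

Lemma in_seg b c a : (a \in seg b c) = (b <= a < c).
Proof. by rewrite inE /= mem_iota; lia. Qed.

Lemma card_seg b c : #|` seg b c| <= c - b.
Proof.
rewrite -[leqRHS](size_iota b).
apply: uniq_leq_size; first exact: fset_uniq.
by move=> a; rewrite in_seg mem_iota; lia.
Qed.

Lemma seg_fle b c : fle b (seg b c).
Proof. by move=> a; rewrite in_seg => /andP[]. Qed.

Lemma seg2 xi b : ~ is_zero xi -> 0 < b -> S xi (seg b (2 * b)).
Proof.
move=> nz b0; apply: schreier_card => //.
  by rewrite /posset /= in_seg; lia.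
apply: fle_leq (seg_fle (c := _)); apply: leq_trans (card_seg _ _) _; lia.
Qed.

(** The intervals [[b, 2b)] and [[2b, 4b)] are in [S_g], and two pieces are allowed because
    [2 <= b]. *)
Lemma seg4_succ g xi b : is_succ g xi -> ~ is_zero g -> 1 < b ->
  S xi (seg b (4 * b)).
Proof.
move=> s nz b1; apply/(schreier_succP _ s); right; exists 2; split=> //.
  by apply: fle_leq b1 _; apply: seg_fle.
have Sd := @schreier_dom_closed g; have S0 := schreier0 g.
apply: (@nfold_cat _ 1 1 _ (2 * b)) => //; apply: nfold1 => //.
  apply: dom_closed_sub (@seg2 g b nz _) => //; last lia.
  by apply/fsubsetP => a; rewrite in_below !in_seg; lia.
apply: dom_closed_sub (@seg2 g (2 * b) nz _) => //; last lia.
by apply/fsubsetP => a; rewrite in_above !in_seg; lia.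
Qed.

Lemma seg4 xi b : ~ is_zero xi -> ~ is_one xi -> 1 < b -> S xi (seg b (4 * b)).
Proof.
move=> nz no b1; case: (ord_case xi) => [//|[[g s]|l]].
  by apply: (seg4_succ s) => // z; apply: no; exists g.
apply/(schreier_limitP _ l); exists 2; split=> //.
  by apply: fle_leq b1 _; apply: seg_fle.
(* [alpha xi 2] is the successor of a nonzero ordinal, since it exceeds [alpha xi 1 = 1]. *)
have [g s] := fundamental_succ alphaP l (isT : 0 < 2).
apply: (seg4_succ s) => // z.
have lt12 := fundamental_incr alphaP l (isT : 0 < 1) (isT : 1 < 2).
have [z' _ [zlt _]] := fundamental_first alphaP l.
have [_ /(_ _ lt12) le1] := s.
by have := lt_le_trans zlt (le_trans le1 (z z')); rewrite ltxx.
Qed.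

Lemma seg8 g xi b : is_succ g xi -> ~ is_zero g -> ~ is_one g -> 1 < b ->
  S xi (seg b (8 * b)).
Proof.
move=> s nz no b1; apply/(schreier_succP _ s); right; exists 2; split=> //.
  by apply: fle_leq b1 _; apply: seg_fle.
have Sd := @schreier_dom_closed g; have S0 := schreier0 g.
apply: (@nfold_cat _ 1 1 _ (4 * b)) => //; apply: nfold1 => //.
  apply: dom_closed_sub (seg4 nz no b1) => //.
  by apply/fsubsetP => a; rewrite in_below !in_seg; lia.
apply: dom_closed_sub (@seg2 g (4 * b) nz _) => //; last lia.
by apply/fsubsetP => a; rewrite in_above !in_seg; lia.
Qed.

(** Let [X] be the smaller set. Its cardinality bounds all points of the union from below, so the
    first [#|X|] points form a member. At most [#|Y|] points remain, and they are at least [#|Y|]: a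
    smaller one and the [#|X|] points before it would all belong to [X]. *)
Lemma one_merging xi : is_one xi -> merging (S xi) 2.
Proof.
move=> o X Y SX SY.
wlog XY : X Y SX SY / #|` X| <= #|` Y|.
  move=> wl; case: (leqP #|` X| #|` Y|) => XY; first exact: wl.
  by rewrite fsetUC; apply: wl => //; apply: ltnW.
have Sd := @schreier_dom_closed xi; have S0 := schreier0 xi.
move: SX SY; rewrite !schreier_oneP // => -[Xp nX] [Yp nY].
have [t ht] := cut_card (X `|` Y) #|` X|.
have Up : posset (X `|` Y) by rewrite /posset /= in_fsetU negb_or Xp Yp.
apply: (@nfold_cat _ 1 1 _ t) => //; apply: nfold1 => //; rewrite schreier_oneP //.
  split; first by move: Up; rewrite /posset /= in_below => /negbTE ->.
  apply: (@fle_leq _ #|` X|); first by case: ht => [->|[]].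
  apply: (fle_sub (below_sub _ _)) => a; rewrite in_fsetU.
  by case/orP => [/nX//|/nY]; apply: leq_trans.
split; first by move: Up; rewrite /posset /= in_above => /negbTE ->.
case: ht => [ht|[_ ->]]; last by [].
have UU : X `|` Y = below (X `|` Y) t `|` above (X `|` Y) t.
  by apply/fsetP => a; fset_lia.
have I0 : below (X `|` Y) t `&` above (X `|` Y) t = fset0.
  by apply/fsetP => a; fset_lia.
have card_ab : #|` above (X `|` Y) t| <= #|` Y|.
  have : #|` X `|` Y| <= #|` X| + #|` Y| by rewrite cardfsU; lia.
  by rewrite {1}UU cardfsU I0 cardfs0 ht; lia.
apply: (fle_leq card_ab) => a; rewrite in_above => /andP[aU ta].
rewrite leqNgt; apply/negP => aY.
have : a |` below (X `|` Y) t `<=` X.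
  apply/fsubsetP => b; rewrite in_fset1U in_below => bU.
  have bY : b < #|` Y| by lia.
  have : b \in X `|` Y by case/orP: bU => [/eqP ->|/andP[]].
  by rewrite in_fsetU => /orP[//|/nY]; lia.
by move=> /fsubset_leq_card; rewrite cardfsU1 ht in_below; lia.
Qed.

(** Let [X] and [Y] have [m <= n] pieces from [S_g], and cut at [n] and [K * n]. Below [n] there are
    only points of [X]; the middle part lies in an interval that is in [S_xi]; the last part has at
    most [M * (m + n) <= K * n] pieces. *)
Lemma succ_merging g xi M K : is_succ g xi -> merging (S g) M ->
  0 < M <= 3 -> 2 * M <= K -> (forall b, 1 < b -> S xi (seg b (K * b))) ->
  merging (S xi) 3.
Proof.
move=> s mg /andP[M0 M3] MK segK X Y SX SY.
have Sd := @schreier_dom_closed xi; have S0 := schreier0 xi.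
have gd := @schreier_dom_closed g; have g0 := schreier0 g.
case/(schreier_succP _ s): (SX) => [->|[m [m0 mX fX]]].
  by rewrite fset0U; apply: (@nfold_leq _ 1) => //; apply: nfold1.
case/(schreier_succP _ s): (SY) => [->|[n [n0 nY fY]]].
  by rewrite fsetU0; apply: (@nfold_leq _ 1) => //; apply: nfold1.
wlog mn : m n X Y SX SY m0 mX fX n0 nY fY / m <= n.
  move=> wl; case: (leqP m n) => mn; first exact: (wl m n).
  by rewrite fsetUC; apply: (wl n m) => //; apply: ltnW.
(* The interval hypothesis requires [n > 1]. For [n = 1] both sets are in [S_g], and merging there
   already gives three members of [S_g]. *)
case: (leqP n 1) => n1.
  have [e1 e2] : m = 1 /\ n = 1 by lia.
  move: fX fY; rewrite e1 e2 => /nfold1E gX /nfold1E gY.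
  have : nfold (S g) 3 (X `|` Y) by apply: (@nfold_leq _ M) => //; apply: mg.
  have XYp : fle 1 (X `|` Y).
    by move=> a; rewrite in_fsetU => /orP[/mX|/nY]; lia.
  have incl Z : S g Z -> S xi Z by apply: succ_sub.
  move: (X `|` Y) => Z [t1 [/incl f1 [t2 [/incl f2 [t3 [/incl f3 e]]]]]].
  by exists t1; split=> //; exists t2; split=> //; exists t3.
apply: (@nfold_cat _ 1 2 _ n) => //.
  apply: nfold1 => //; rewrite belowU.
  rewrite (_ : below Y n = fset0).
    rewrite fsetU0; apply: dom_closed_sub SX => //; exact: below_sub.
  by apply/fsetP => a; rewrite in_below in_fset0; apply/negP => /andP[/nY]; lia.
apply: (@nfold_cat _ 1 1 _ (K * n)) => //; apply: nfold1 => //.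
  apply: dom_closed_sub (segK _ n1) => //.
  by apply/fsubsetP => a; rewrite in_below in_above in_seg; lia.
rewrite above_above; apply/(schreier_succP _ s); right; exists (K * n).
have Kn : n <= K * n by nia.
rewrite (maxn_idPr Kn); split; first nia; first exact: fle_above.
apply: (@nfold_leq _ (M * (m + n))) => //; first nia.
by apply: nfold_sub (above_sub _ _) _ => //; apply: nfold_merge.
Qed.

Lemma schreier_merging xi : ~ is_zero xi -> merging (S xi) 3.
Proof.
elim/(well_founded_ind wfW): xi => xi IH nz.
have Sd := @schreier_dom_closed xi; have S0 := schreier0 xi.
case: (ord_case xi) => [//|[[g s]|l]].
  have [z|z] := EM (is_zero g).
    move=> X Y SX SY; apply: (@nfold_leq _ 2) => //.
    by apply: one_merging => //; exists g.
  (* The merging constant is 2 for [g = 1] and 3 beyond; the factors 4 and 8 are at least twice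
     these constants. *)
  have [o|o] := EM (is_one g).
    apply: (@succ_merging _ _ 2 4 s (one_merging o)) => // b b1.
    exact: (seg4_succ s).
  have mg : merging (S g) 3 by apply: IH => //; case: s.
  apply: (@succ_merging _ _ 3 8 s mg) => // b b1.
  exact: (seg8 s).
move=> X Y SX SY.
case/(schreier_limitP _ l): (SX) => m [m0 mX fX].
case/(schreier_limitP _ l): (SY) => n [n0 nY fY].
wlog mn : m n X Y SX SY m0 mX fX n0 nY fY / m <= n.
  move=> wl; case: (leqP m n) => mn; first exact: (wl m n).
  by rewrite fsetUC; apply: (wl n m) => //; apply: ltnW.
have an := @schreier_dom_closed (alpha xi n).
have mg : merging (S (alpha xi n)) 3.
  by apply: IH; [apply: fundamental_lt|apply: alpha_not_zero].
case: (leqP n 1) => n1.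
  have [e1 e2] : m = 1 /\ n = 1 by lia.
  rewrite e1 in fX mX; rewrite e2 in fY nY mg.
  have XYp : fle 1 (X `|` Y).
    by move=> a; rewrite in_fsetU => /orP[/mX|/nY].
  have incl Z : S (alpha xi 1) Z -> S xi Z.
    move=> SZ; apply/(schreier_limitP _ l); exists 1; split=> //.
    by apply/posset_fle; apply: schreier_posset SZ.
  move: (X `|` Y) (mg _ _ fX fY) => Z.
  move=> [t1 [/incl f1 [t2 [/incl f2 [t3 [/incl f3 e]]]]]].
  by exists t1; split=> //; exists t2; split=> //; exists t3.
(* One piece is spent below [n], where [Y] has no points. Beyond [n], induction at [alpha xi n]
   gives three pieces, which must be reduced to two. *)
apply: (@nfold_cat _ 1 2 _ n) => //.
  apply: nfold1 => //; rewrite belowU.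
  rewrite (_ : below Y n = fset0).
    rewrite fsetU0; apply: dom_closed_sub SX => //; exact: below_sub.
  by apply/fsetP => a; rewrite in_below in_fset0; apply/negP => /andP[/nY]; lia.
rewrite aboveU (fle_aboveE nY); set Z := _ `|` Y.
have nZ : fle n Z.
  by move=> a; rewrite in_fsetU in_above => /orP[/andP[]//|/nY].
have fX' : S (alpha xi n) (above X n).
  apply: (alpha_mono l m0 mn); first exact: fle_leq n1 (fle_above (A := _)).
  by apply: dom_closed_sub fX; [apply: schreier_dom_closed|apply: above_sub].
have [t1 [f1 f23]] := mg _ _ fX' fY.
have incl B : B `<=` Z -> S (alpha xi n) B -> S xi B.
  move=> BZ SB; apply/(schreier_limitP _ l); exists n; split=> //.
  exact: fle_sub BZ nZ.
(* If the first piece is empty, two pieces remain. Otherwise it has a point at or beyond [n], so the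
   other two start at [n.+1] or later and may be united at [alpha xi n.+1]. *)
case: (eqVneq (below Z t1) fset0) => [Z0|/fset0Pn[a]].
  have Za : above Z t1 = Z.
    apply/fsetP => b; move/fsetP: Z0 => /(_ b).
    by rewrite in_below in_above in_fset0; case: (b \in Z) => //=; lia.
  case: f23 => t2 [f2 [t3 [f3 e]]]; rewrite Za in f2 f3 e.
  exists t2; split; first by apply: incl f2; apply: below_sub.
  exists t3; split=> //; apply: incl f3.
  exact: fsubset_trans (below_sub _ _) (above_sub _ _).
rewrite in_below => /andP[/nZ na at1].
exists t1; split; first by apply: incl f1; apply: below_sub.
case: f23 => t2 [f2 /nfold1E f3].
apply: nfold1 => //; apply/(schreier_limitP _ l); exists n.+1; split=> //.
  by apply: fle_leq (fle_above (A := _)); lia.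
rewrite (_ : above Z t1 = below (above Z t1) t2 `|` above (above Z t1) t2).
  apply: fundamental_union => //.
    by apply: (fle_sub (below_sub _ _)); apply: fle_leq (fle_above (A := _)); lia.
  by move=> b c; rewrite in_below !in_above; lia.
by apply/fsetP => b; fset_lia.
Qed.

(* Since [b, c] is not in [S xi], [c] is so large that two sets which are not
   larger than members of [S xi] starting at [b] can be merged beyond [c]. *)
Lemma schreier_union xi b c E1 E2 D1 D2 : ~ is_zero xi -> 0 < b ->
  ~ S xi (seg b c.+1) -> S xi E1 -> S xi E2 ->
  (exists2 e, e \in E1 & e <= b) -> (exists2 e, e \in E2 & e <= b) ->
  dom 1 D1 E1 -> dom 1 D2 E2 -> fle c D1 -> fle c D2 -> S xi (D1 `|` D2).
Proof.
move=> nz b0 nseg SE1 SE2 [e1 e1E e1b] [e2 e2E e2b] D1E D2E cD1 cD2.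
have Sd := @schreier_dom_closed xi; have S0 := schreier0 xi.
(* By heredity an interval [[b, kb)] in [S_xi] cannot contain [[b, c]], so [kb <= c]. *)
have seg_c k : S xi (seg b (k * b)) -> k * b <= c.
  move=> sk; rewrite leqNgt; apply/negP => ck; apply: nseg.
  apply: dom_closed_sub sk => //.
  by apply/fsubsetP => a; rewrite !in_seg; lia.
have c2 : 2 * b <= c by apply: seg_c; apply: seg2.
have cU : fle c (D1 `|` D2) by move=> a; rewrite in_fsetU => /orP[/cD1|/cD2].
have E1p := schreier_posset SE1; have E2p := schreier_posset SE2.
have Up : posset (D1 `|` D2) by apply/posset_fle; apply: fle_leq cU; lia.
have cardU : #|` D1 `|` D2| <= #|` E1| + #|` E2|.
  have := dom_card D1E; have := dom_card D2E.
  by rewrite cardfsU; lia.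
have e10 : 0 < e1 by move/posset_fle: E1p => /(_ _ e1E).
have e20 : 0 < e2 by move/posset_fle: E2p => /(_ _ e2E).
(* If [b = 1], both [E1] and [E2] contain 1, so they are singletons; the union has at most two
   points, and [2 <= c]. *)
case: (leqP b 1) => b1.
  apply: schreier_card => //; apply: fle_leq cU.
  have i1 : 1 \in E1 by rewrite (_ : 1 = e1) //; lia.
  have i2 : 1 \in E2 by rewrite (_ : 1 = e2) //; lia.
  by have := schreier_has1 SE1 i1; have := schreier_has1 SE2 i2; lia.
(* Having a point up to [b], each of [E1] and [E2] has at most [b] pieces from [S_g]. Merging yields
   at most [2 * M * b <= K * b <= c] pieces. *)
have succ_case g M K : is_succ g xi -> merging (S g) M -> 2 * M <= K ->
    K * b <= c -> S xi (D1 `|` D2).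
  move=> s mg MK Kc; apply/(schreier_succP _ s); right; exists c.
  have gd := @schreier_dom_closed g; have g0 := schreier0 g.
  split=> //; first lia.
  apply: (@nfold_leq _ (M * (b + b))) => //; first nia.
  have fold e E D : S xi E -> e \in E -> e <= b -> dom 1 D E -> nfold (S g) b D.
    move=> SE eE eb DE; apply: (nfold_dom gd DE).
    case/(schreier_succP _ s): SE => [E0|[n [n0 nE fE]]].
      by rewrite E0 in eE.
    by apply: nfold_leq fE => //; have := nE _ eE; lia.
  by apply: nfold_merge => //; [apply: fold D1E|apply: fold D2E]; eassumption.
case: (ord_case xi) => [//|[[g s]|l]].
  have [z|z] := EM (is_zero g).
    apply: schreier_card => //; apply: fle_leq cU.
    have o : is_one xi by exists g.
    move: SE1 SE2; rewrite !schreier_oneP // => -[_ /(_ _ e1E) h1] [_ /(_ _ e2E) h2].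
    lia.
  have [o|o] := EM (is_one g).
    apply: (succ_case g 2 4) => //; first exact: one_merging.
    by apply: seg_c; apply: (seg4_succ s).
  apply: (succ_case g 3 8) => //; first exact: schreier_merging.
  by apply: seg_c; apply: (seg8 s).
have ab := @schreier_dom_closed (alpha xi b).
have lim e E D : S xi E -> e \in E -> e <= b -> dom 1 D E -> fle c D ->
    S (alpha xi b) D.
  move=> SE eE eb DE cD; case/(schreier_limitP _ l): SE => n [n0 nE fE].
  apply: (alpha_mono l n0); first by have := nE _ eE; lia.
    by apply: fle_leq cD; lia.
  by apply: schreier_dom_closed fE.
have {lim} [f1 f2] : S (alpha xi b) D1 /\ S (alpha xi b) D2.
  by split; [apply: lim D1E cD1|apply: lim D2E cD2]; eassumption.
have [t1 [h1 [t2 [h2 /nfold1E h3]]]] :=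
  schreier_merging (alpha_not_zero l b0) f1 f2.
move: (D1 `|` D2) cU h1 h2 h3 => Z cZ h1 h2 h3.
(* The three pieces in the family of [alpha xi b] are united in two steps, each raising the index by
   one; [b + 2 <= 2 * b <= c] since [b >= 2]. *)
apply/(schreier_limitP _ l); exists b.+2; split=> //.
  by apply: fle_leq cZ; lia.
have Z2 : fle 2 Z by apply: fle_leq cZ; lia.
have h1' : S (alpha xi b.+1) (below Z t1).
  by apply: alpha_mono h1 => //; apply: fle_sub (below_sub _ _) Z2.
have h23 : S (alpha xi b.+1) (above Z t1).
  rewrite (_ : above Z t1 = below (above Z t1) t2 `|` above (above Z t1) t2).
    apply: fundamental_union => //.
      apply: fle_sub Z2; exact: fsubset_trans (below_sub _ _) (above_sub _ _).
    by move=> x y; rewrite in_below !in_above; lia.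
  by apply/fsetP => a; fset_lia.
rewrite (_ : Z = below Z t1 `|` above Z t1).
  apply: fundamental_union => //; first exact: fle_sub (below_sub _ _) Z2.
  by move=> x y; rewrite in_below !in_above; lia.
by apply/fsetP => a; fset_lia.
Qed.

(** Over a successor of a nonzero [g], cut at [2 * n] and [4 * n]: the first two parts lie in
    intervals of [S_xi], and the rest has at most [3 * n] pieces by induction. A limit inherits the
    claim from [alpha xi n]. *)
Lemma schreier_three xi C A : ~ is_zero xi -> S xi A -> dom 6 C A ->
  nfold (S xi) 3 C.
Proof.
elim/(well_founded_ind wfW): xi C A => xi IH C A nz SA CA.
have Sd := @schreier_dom_closed xi; have S0 := schreier0 xi.
have Cp : posset C by apply: dom_posset CA _; apply: schreier_posset SA.
have posB t : posset (below C t).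
  by apply: posset_sub (below_sub _ _) _.
have posA t : posset (above C t).
  by apply: posset_sub (above_sub _ _) _.
case: (ord_case xi) => [//|[[g s]|l]].
  have [z|z] := EM (is_zero g).
    have o : is_one xi by exists g.
    move: SA; rewrite schreier_oneP // => -[Ap nA].
    have nC := dom_fle CA nA; have cC := dom_card CA.
    move: nC cC; set n := #|` A| => nC cC {nA}.
    (* In [S_1], removing the first [m] points of a set in [[m, oo)] leaves a set in [[2m, oo)].
       From [n] on, two steps remove [n] and then [2 * n] of at most [6 * n] points; at most [3 * n]
       are left, in [[4n, oo)]. *)
    have step D m : fle m D -> posset D ->
        exists t, [/\ S xi (below D t), posset (above D t) &
          above D t = fset0 \/ fle (m + m) (above D t) /\ m + #|` above D t| = #|` D|].
      move=> mD Dp; have [t ht] := cut_card D m; exists t; split.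
      - rewrite schreier_oneP //; split.
          by apply: posset_sub (below_sub _ _) _.
        apply: fle_leq (fle_sub (below_sub _ _) mD); by case: ht => [->|[]].
      - by apply: posset_sub (above_sub _ _) _.
      - case: ht => [ht|[_ ->]]; [right|by left]; split.
          move=> a; rewrite in_above => /andP[aD ta].
          suff : #|` below D t| <= a - m by have := mD _ aD; rewrite ht; lia.
          apply: leq_trans (card_seg m a); apply: fsubset_leq_card.
          by apply/fsubsetP => b; rewrite in_below in_seg => /andP[/mD ->]; lia.
        have DU : D = below D t `|` above D t by apply/fsetP => a; fset_lia.
        have I0 : below D t `&` above D t = fset0 by apply/fsetP => a; fset_lia.
        by rewrite {2}DU cardfsU I0 cardfs0 ht subn0.
    have [t1 [h1 p1 [e|[f1 c1]]]] := step C n nC Cp.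
      by exists t1; rewrite e; split=> //; apply: nfold0.
    exists t1; split=> //.
    have [t2 [h2 p2 [e|[f2 c2]]]] := step _ _ f1 p1.
      by exists t2; rewrite e; split=> //; apply: nfold0.
    exists t2; split=> //; apply: nfold1 => //; rewrite schreier_oneP //.
    by split=> //; apply: fle_leq f2; lia.
  case/(schreier_succP _ s): (SA) => [A0|[n [n0 nA fA]]].
    rewrite (_ : C = fset0); first exact: nfold0.
    apply/eqP; rewrite -cardfs_eq0 -leqn0.
    by apply: leq_trans (dom_card CA) _; rewrite A0 cardfs0.
  have nC := dom_fle CA nA.
  have gd := @schreier_dom_closed g; have g0 := schreier0 g.
  have fC : nfold (S g) (n * 3) C.
    apply: (nfold_mul gd _ CA fA) => C' A' CA' SA'.
    by apply: IH CA' => //; case: s.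
  apply: (@nfold_cat _ 1 2 _ (2 * n)) => //.
    apply: nfold1 => //; apply: dom_closed_sub (seg2 nz n0) => //.
    by apply/fsubsetP => a; rewrite in_below in_seg => /andP[/nC ->].
  apply: (@nfold_cat _ 1 1 _ (4 * n)) => //; apply: nfold1 => //.
    apply: (@dom_closed_sub _ _ (seg (2 * n) (2 * (2 * n)))) => //.
      by apply/fsubsetP => a; rewrite in_below in_above in_seg; lia.
    by apply: seg2 => //; lia.
  apply/(schreier_succP _ s); right; exists (4 * n); split; first lia.
    exact: fle_above.
  apply: (@nfold_leq _ (n * 3)) => //; first lia.
  by apply: nfold_sub fC => //; apply: fsubset_trans (above_sub _ _) (above_sub _ _).
case/(schreier_limitP _ l): (SA) => n [n0 nA fA].
have nC := dom_fle CA nA.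
have incl B : B `<=` C -> S (alpha xi n) B -> S xi B.
  move=> BC SB; apply/(schreier_limitP _ l); exists n; split=> //.
  exact: fle_sub BC nC.
have [t1 [h1 [t2 [h2 /nfold1E h3]]]] :
    nfold (S (alpha xi n)) 3 C.
  by apply: IH CA => //; [apply: fundamental_lt|apply: alpha_not_zero].
exists t1; split; first by apply: incl h1; apply: below_sub.
exists t2; split.
  by apply: incl h2; apply: fsubset_trans (below_sub _ _) (above_sub _ _).
apply: nfold1 => //; apply: incl h3.
exact: fsubset_trans (above_sub _ _) (above_sub _ _).
Qed.

End Schreier.

(** * Trees of decompositions *)

Section Trees.
Local Open Scope fset_scope.
Local Open Scope nat_scope.
Implicit Types (A B C D E S U V X : {fset nat}) (F : {fset nat} -> Prop).
Implicit Types (h p q g : nat -> nat).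

(* A tree of [F]-allowable ([F]-admissible, if [mono]) decompositions with set
   of leaves [A], the leaf [n] being at depth at most [h n]; the pieces of a
   decomposition are the fibres of the map [p] sending a point to the least
   element of its piece. *)
Inductive leveled (mono : Prop) F : (nat -> nat) -> {fset nat} -> Prop :=
| leveled_leaf h n : 0 < n -> leveled mono F h [fset n]
| leveled_node h A p :
    posset A -> (forall n, n \in A -> 0 < h n) ->
    (forall n, n \in A -> [/\ p n \in A, p n <= n & p (p n) = p n]) ->
    (mono -> {in A &, {homo p : m n / m <= n}}) ->
    F [fset p n | n in A] ->
    (forall n, n \in A ->
       leveled mono F (fun m => (h m).-1) [fset m in A | p m == p n]) ->
    leveled mono F h A.

Lemma fminP A : A != fset0 -> fmin A \in A /\ fle (fmin A) A.
Proof.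
move=> /fset0Pn[a aA]; rewrite /fmin.
have sA b : (b \in sort leq A) = (b \in A) by rewrite mem_sort.
have sorted_A := sort_sorted leq_total A.
case: (sort leq A) sA sorted_A => [|m s] sA sorted_A.
  by move: (sA a); rewrite aA.
split=> [|b]; first by rewrite -sA mem_head.
rewrite -sA inE => /orP[/eqP -> //|bs].
by move: sorted_A; rewrite /= (path_sortedE leq_trans) => /andP[/allP/(_ _ bs)].
Qed.

Lemma fmin_eq A m : m \in A -> fle m A -> fmin A = m.
Proof.
move=> mA mle; have A0 : A != fset0 by apply/fset0Pn; exists m.
have [fA fle_] := fminP A0; apply/eqP; rewrite eqn_leq.
by rewrite fle_ //= mle.
Qed.

(** * Relabelling, restricting and splitting trees *)

Definition cmin q S n := fmin [fset m in S | q m == q n].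

Definition mins q S := [fset cmin q S n | n in S].

Lemma in_fibre (Q : nat -> bool) S m : (m \in [fset m in S | Q m]) = (m \in S) && Q m.
Proof. by rewrite !inE. Qed.

Lemma cminP q S n : n \in S ->
  [/\ cmin q S n \in S, q (cmin q S n) = q n &
      forall m, m \in S -> q m = q n -> cmin q S n <= m].
Proof.
move=> nS; have : [fset m in S | q m == q n] != fset0.
  by apply/fset0Pn; exists n; rewrite in_fibre nS eqxx.
move=> /fminP; rewrite -/(cmin q S n) in_fibre => -[/andP[cS /eqP qc] cle].
split=> // m mS qm; apply: cle.
by rewrite in_fibre mS qm eqxx.
Qed.

Lemma cmin_eq q S m n : q m = q n -> cmin q S m = cmin q S n.
Proof. by rewrite /cmin => ->. Qed.

Lemma minsP q S c : reflect (c \in S /\ cmin q S c = c) (c \in mins q S).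
Proof.
apply: (iffP (imfsetP _ _ _ _)) => /= [[n nS ->]|[cS ce]]; last by exists c.
by have [cS qc _] := cminP q nS; split=> //; apply: cmin_eq.
Qed.

Lemma mins_inj q S : {in mins q S &, injective q}.
Proof.
move=> c c' /minsP[cS ce] /minsP[cS' ce'] qe.
by rewrite -ce -ce'; apply: cmin_eq.
Qed.

Lemma mins_sub q S : mins q S `<=` S.
Proof. by apply/fsubsetP => c /minsP[]. Qed.

(** Pieces may carry arbitrary labels [q]: [cmin q B] has the same fibres, and is monotone whenever
    [q] is. *)
Lemma leveled_classes (mono : Prop) F h q B :
  posset B -> (forall n, n \in B -> 0 < h n) ->
  (mono -> {in B &, {homo q : m n / m <= n}}) ->
  F (mins q B) ->
  (forall n, n \in B ->
     leveled mono F (fun m => (h m).-1) [fset m in B | q m == q n]) ->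
  leveled mono F h B.
Proof.
move=> Bp h0 qm FB lB; apply: (@leveled_node _ _ _ _ (cmin q B)) => //.
- move=> n nB; have [cB qc cle] := cminP q nB; split=> //; first exact: cle.
  exact: cmin_eq.
- move=> /qm{}qm m n mB nB mn.
  have [cm qcm lem] := cminP q mB; have [cn qcn len] := cminP q nB.
  have [qmn|qmn] := eqVneq (q m) (q n); first by rewrite (cmin_eq _ qmn).
  rewrite leqNgt; apply/negP => /ltnW /(qm _ _ cn cm).
  by rewrite qcm qcn => qnm; have := qm _ _ mB nB mn; move: qmn; lia.
- move=> n nB; rewrite (_ : [fset m in B | _] = [fset m in B | q m == q n]).
    exact: lB.
  apply/fsetP => m; rewrite !in_fibre; case: (boolP (m \in B)) => //= mB.
  have [_ qcm _] := cminP q mB; have [_ qcn _] := cminP q nB.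
  by apply/eqP/eqP => [e|/cmin_eq ->//]; rewrite -qcm -qcn e.
Qed.

Lemma leveled0 mono F h : F fset0 -> leveled mono F h fset0.
Proof.
move=> F0; apply: (@leveled_node _ _ _ _ id) => //.
by rewrite (_ : [fset _ | _ in _] = fset0) //; apply: imfset0.
Qed.

(** When pieces shrink, their minima move to the right and some disappear, which [dom_closed]
    permits. *)
Lemma leveled_sub mono F h A B : dom_closed F -> F fset0 ->
  B `<=` A -> leveled mono F h A -> leveled mono F h B.
Proof.
move=> Fd F0 + lA; elim: lA B => {h A} [h n n0|h A p Ap h0 pA pm FA _ IH] B BA.
  have [->|/fset0Pn[b bB]] := eqVneq B fset0; first exact: leveled0.
  suff -> : B = [fset n] by apply: leveled_leaf.
  apply/eqP; rewrite eqEfsubset BA; apply/fsubsetP => x; rewrite inE => /eqP ->.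
  by have := fsubsetP BA _ bB; rewrite inE => /eqP <-.
move/fsubsetP: (BA) => BA'.
apply: (@leveled_classes _ _ _ p).
- exact: posset_sub Ap.
- by move=> n /BA'/h0.
- by move=> /pm{}pm m n /BA' mA /BA' nA; apply: pm.
- apply: Fd FA; apply: (@dom_inj p); first exact: mins_inj.
    by move=> c /minsP[/BA' cA _]; apply/imfsetP; exists c.
  by move=> c /minsP[/BA' cA _]; case: (pA c cA).
- move=> n /BA' nA; apply: (IH n nA); apply/fsubsetP => m.
  by rewrite !in_fibre => /andP[/BA' -> ->].
Qed.

(** The second alternative serves families such as [S_0], whose members are so small that [p] must
    be constant. *)
Lemma leveled_weaken (mono mono' : Prop) F F' h A :
  (forall X, F X -> F' X) ->
  (mono' -> mono \/ forall B p, F [fset p n | n in B] ->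
     {in B &, {homo p : m n / m <= n}}) ->
  leveled mono F h A -> leveled mono' F' h A.
Proof.
move=> FF' mm; elim=> {h A} [h n n0|h A p Ap h0 pA pm FA _ IH].
  exact: leveled_leaf.
apply: (@leveled_node _ _ _ _ p) => //; last exact: FF'.
by move=> /mm[/pm//|]; apply.
Qed.

(** For a hereditary and spreading family of sets of positive integers this is [F[A_k]], expressed
    by counting. *)
Definition multiplied k F C := exists2 A, F A & dom k C A.

(** By induction each piece splits into three successive trees. The refined pieces have at most
    three minima per old piece, so their minima are dominated 6-fold by a member of [F] and split
    into three successive members. A point goes to the part that contains the minimum of its refined
    piece. *)
Lemma leveled_split F h A :
  dom_closed F -> F fset0 ->
  (forall C X, F X -> dom 6 C X -> nfold F 3 C) ->
  leveled True (multiplied 2 F) h A ->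
  exists j, [/\ {in A &, {homo j : m n / m <= n}}, forall n, n \in A -> j n < 3 &
    forall i, leveled True F h [fset n in A | j n == i]].
Proof.
move=> Fd F0 F6; elim=> {h A} [h n n0|h A p Ap h0 pA /(_ I) pm [A0 FA0 C2] _ IH].
  exists (fun=> 0); split=> // i.
  apply: (@leveled_sub _ _ _ [fset n]) => //; last exact: leveled_leaf.
  by apply/fsubsetP => m; rewrite in_fibre => /andP[].
have {IH} /choice[J JP] : forall c, exists j, c \in A ->
    [/\ {in [fset m in A | p m == p c] &, {homo j : m n / m <= n}},
     forall n, n \in [fset m in A | p m == p c] -> j n < 3 &
     forall i, leveled True F (fun m => (h m).-1)
       [fset n in [fset m in A | p m == p c] | j n == i]].
  move=> c; case: (boolP (c \in A)) => [/IH[j jP]|_]; first by exists j.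
  by exists id.
pose j n := J (p n) n.
have j3 n : n \in A -> j n < 3.
  move=> nA; have [pnA _ ppn] := pA n nA; have [_ j3 _] := JP _ pnA.
  by apply: j3; rewrite in_fibre nA ppn eqxx.
(* As [j n < 3], this orders the refined pieces first by old piece and then by part. *)
pose q n := 3 * p n + j n.
have qE m n : m \in A -> n \in A -> q m = q n -> p m = p n /\ j m = j n.
  by move=> mA nA; have := j3 m mA; have := j3 n nA; rewrite /q; lia.
have qm : {in A &, {homo q : m n / m <= n}}.
  move=> m n mA nA mn; have := pm _ _ mA nA mn.
  rewrite leq_eqVlt => /orP[/eqP pe|]; last first.
    by have := j3 m mA; have := j3 n nA; rewrite /q; lia.
  have [pnA _ ppn] := pA n nA; have [jm _ _] := JP _ pnA.
  rewrite /q /j pe leq_add2l; apply: jm => //; rewrite in_fibre ?mA ?nA ppn ?pe eqxx //.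
have X6 : dom 6 (mins q A) A0.
  apply: (@dom_trans 3 2 _ [fset p n | n in A]) => //.
  apply: (@dom_inj_mul 3 j p).
  - move=> c c' cm cm' [pe je]; apply: (mins_inj cm cm').
    by rewrite /q pe je.
  - by move=> c /minsP[cA _]; apply: j3.
  - by move=> c /minsP[cA _]; apply/imfsetP; exists c.
  - by move=> c /minsP[/pA[]].
have [t1 [F1 [t2 [F2 /nfold1E F3]]]] := F6 _ _ FA0 X6.
(* The part of [c], numbered from 0 to 2; the maximum covers the case [t2 < t1]. *)
pose k c := (t1 <= c) + (maxn t1 t2 <= c).
have km m n : m <= n -> k m <= k n by rewrite /k; lia.
have FK i : F [fset c in mins q A | k c == i].
  case: i => [|[|[|i]]].
  - rewrite (_ : [fset c in _ | _] = below (mins q A) t1) //.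
    by apply/fsetP => c; rewrite in_fibre in_below /k; lia.
  - rewrite (_ : [fset c in _ | _] = below (above (mins q A) t1) t2) //.
    by apply/fsetP => c; rewrite in_fibre in_below in_above /k; lia.
  - rewrite (_ : [fset c in _ | _] = above (above (mins q A) t1) t2) //.
    by apply/fsetP => c; rewrite in_fibre !in_above /k; lia.
  - rewrite (_ : [fset c in _ | _] = fset0) //.
    by apply/fsetP => c; rewrite in_fibre in_fset0 /k; lia.
exists (fun n => k (cmin q A n)); split.
- move=> m n mA nA mn; apply: km.
  have [cm qcm lem] := cminP q mA; have [cn qcn len] := cminP q nA.
  rewrite leqNgt; apply/negP => lt_nm.
  have := qm _ _ cn cm (ltnW lt_nm); rewrite qcm qcn => qnm.
  have qe : q m = q n by apply/eqP; rewrite eqn_leq qm.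
  by move: lt_nm; rewrite (cmin_eq _ qe) ltnn.
- by move=> n _; rewrite /k; lia.
- move=> i; set B := [fset n in A | _].
  have BA : B `<=` A by apply/fsubsetP => m; rewrite in_fibre => /andP[].
  move/fsubsetP: (BA) => BA'.
  apply: (@leveled_classes _ _ _ q).
  + exact: posset_sub Ap.
  + by move=> n /BA'/h0.
  + by move=> _ m n /BA' mA /BA' nA; apply: qm.
  + apply: Fd (FK i); apply: (@dom_inj (cmin q A)).
    * move=> c c' cm cm' e; apply: (mins_inj cm cm').
      have [cB _] := minsP _ _ _ cm; have [cB' _] := minsP _ _ _ cm'.
      have [_ qc _] := cminP q (BA' _ cB); have [_ qc' _] := cminP q (BA' _ cB').
      by rewrite -qc -qc' e.
    * move=> c /minsP[cB _]; rewrite in_fibre.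
      have cA := BA' _ cB; move: cB; rewrite in_fibre => /andP[_ ->].
      by rewrite andbT; apply/imfsetP; exists c.
    * by move=> c /minsP[/BA' cA _]; have [_ _ cle] := cminP q cA; apply: cle.
  + move=> n /BA' nA; have [pnA _ ppn] := pA n nA; have [_ _ lj] := JP _ pnA.
    apply: leveled_sub (lj (j n)) => //; apply/fsubsetP => m.
    rewrite in_fibre => /andP[/BA' mA /eqP qmn]; have [pe je] := qE _ _ mA nA qmn.
    by rewrite !in_fibre mA pe ppn eqxx -je /j pe eqxx.
Qed.

(** A leaf counts as a node whose only piece is itself; the last clause records that depth 0 forces
    a leaf. *)
Lemma leveled_children F h B : dom_closed F -> (forall n, 0 < n -> F [fset n]) ->
  leveled False F h B -> exists q,
  [/\ forall n, n \in B -> q n \in B /\ q n <= n,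
      F [fset q n | n in B],
      forall n, n \in B ->
        leveled False F (fun m => (h m).-1) [fset m in B | q m == q n] &
      forall n, n \in B -> h n = 0 -> B = [fset n]].
Proof.
move=> Fd F1; case=> {h B} [h n n0|h B p Bp h0 pB _ FB lB].
  exists id; split=> //.
  - by rewrite imfset_id; apply: F1.
  - move=> m; rewrite inE => /eqP ->.
    apply: (@leveled_sub _ _ _ [fset n]) => //; last exact: leveled_leaf.
      by apply: dom_closed0 (F1 _ n0).
    by apply/fsubsetP => x; rewrite in_fibre => /andP[].
  - by move=> m; rewrite inE => /eqP ->.
exists p; split=> //; first by move=> n /pB[].
by move=> n /h0; case: (h n).
Qed.

(** * Greedy cutting of the first two generations of a tree *)

Section Cuts.
Variable F : {fset nat} -> Prop.
Hypothesis Fd : dom_closed F.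
Hypothesis F1 : forall n, 0 < n -> F [fset n].
Hypothesis Funion : forall b c E1 E2 D1 D2, 0 < b -> ~ F (seg b c.+1) ->
  F E1 -> F E2 ->
  (exists2 e, e \in E1 & e <= b) -> (exists2 e, e \in E2 & e <= b) ->
  dom 1 D1 E1 -> dom 1 D2 E2 -> fle c D1 -> fle c D2 -> F (D1 `|` D2).

Let F0 : F fset0.
Proof. exact: dom_closed0 (F1 (ltn0Sn 0)). Qed.

(** Moving the least point of [D] down to [c] is harmless: until [mu] is passed, a point of [E] not
    exceeding [c] pays for [c]. *)
Lemma dom_lower c mu D E : dom 1 D E -> (exists2 e, e \in E & e <= c) ->
  fle c D -> mu \in D -> fle mu D -> dom 1 (c |` (D `\ mu)) E.
Proof.
move=> DE [e eE ec] cD muD muleD t.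
case: (leqP t c) => tc.
  rewrite (_ : below _ t = fset0) ?cardfs0 //; apply/fsetP => a.
  rewrite in_below in_fset1U in_fsetD1 in_fset0.
  by apply/negP => /andP[/orP[/eqP ->|/andP[_ /cD]]]; lia.
have e1 : 0 < #|` below E t|.
  by rewrite cardfs_gt0; apply/fset0Pn; exists e; rewrite in_below eE; lia.
case: (leqP t mu) => tmu.
  apply: (@leq_trans 1); last by rewrite mul1n.
  rewrite -(cardfs1 c); apply: fsubset_leq_card; apply/fsubsetP => a.
  rewrite in_below in_fset1U in_fsetD1 inE.
  by move=> /andP[/orP[//|/andP[_ /muleD]]]; lia.
apply: leq_trans (DE t).
have muB : mu \in below D t by rewrite in_below muD.
rewrite (cardfsD1 mu (below D t)) muB.
apply: leq_trans (_ : _ <= #|` c |` (below D t `\ mu)|) _.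
  apply: fsubset_leq_card; apply/fsubsetP => a.
  rewrite in_below !in_fset1U !in_fsetD1 in_below.
  by case/andP => /orP[->//|/andP[-> ->]] ->; rewrite orbT.
by rewrite cardfsU1 leq_add2r leq_b1.
Qed.

(** The next absorption needs a point of [E] up to [c], so the least point of the union is moved
    down to [c] before [Funion] is applied. *)
Lemma union_lower b c E1 E2 D1 D2 : 0 < b -> b <= c -> ~ F (seg b c.+1) ->
  F E1 -> F E2 ->
  (exists2 e, e \in E1 & e <= b) -> (exists2 e, e \in E2 & e <= b) ->
  dom 1 D1 E1 -> dom 1 D2 E2 -> fle c D1 -> fle c D2 ->
  exists E, [/\ F E, exists2 e, e \in E & e <= c & dom 1 (D1 `|` D2) E].
Proof.
move=> b0 bc nseg FE1 FE2 h1 h2 d1 d2 c1 c2.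
have [->|U0] := eqVneq (D1 `|` D2) fset0.
  exists [fset c]; split; first by apply: F1; lia.
    by exists c => //; rewrite inE.
  exact/sub_dom/fsub0set.
have [muU mule] := fminP U0; move: (fmin _) muU mule => mu muU mule.
wlog mu1 : E1 E2 D1 D2 FE1 FE2 h1 h2 d1 d2 c1 c2 U0 muU mule / mu \in D1.
  move=> wl; have := muU; rewrite in_fsetU => /orP[mu1|mu2].
    exact: (wl E1 E2 D1 D2).
  rewrite fsetUC in U0 muU mule *.
  exact: (wl E2 E1 D2 D1).
exists ((c |` (D1 `\ mu)) `|` D2); split.
- apply: (Funion b0 nseg FE1 FE2) => //.
    apply: dom_lower => //; first by case: h1 => e eE eb; exists e => //; lia.
    by apply: fle_sub mule; apply: fsubsetUl.
  move=> a; rewrite in_fset1U in_fsetD1 => /orP[/eqP -> //|/andP[_ /c1]//].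
- by exists c => //; rewrite in_fsetU in_fset1U eqxx.
- have cmu := c1 _ mu1.
  apply: (@dom_inj (fun x => if x == mu then c else x)).
  + move=> x y xU yU; have := mule x xU; have := mule y yU.
    by case: eqP; case: eqP; lia.
  + move=> x; rewrite !inE.
    by case: (eqVneq x mu) => [_ _|ne /orP[->|->]]; rewrite ?eqxx ?ne ?orbT.
  + by move=> x xU; case: eqP => [->|].
Qed.

Variables (A : {fset nat}) (h p q : nat -> nat).
Hypothesis Ap : posset A.
Hypothesis pA : forall n, n \in A -> [/\ p n \in A, p n <= n & p (p n) = p n].
Hypothesis qA : forall n, n \in A -> [/\ q n \in A, q n <= n & p (q n) = p n].
Hypothesis Fq : forall n, n \in A -> F [fset q m | m in [fset m in A | p m == p n]].
Hypothesis lq : forall n, n \in A ->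
  leveled False F (fun m => (h m).-2) [fset m in A | q m == q n].
Hypothesis leafA : forall m n, m \in A -> n \in A -> h n <= 1 -> p m = p n -> m = n.
Hypothesis FpA : F [fset p n | n in A].

(** The values of [g] are the cuts, and [beta t] is the budget for those before [t]; none precedes
    [c], so only [t > c] is constrained. *)
Definition cuttable c (beta : nat -> nat) := exists g,
  [/\ forall n, n \in above A c -> [/\ g n \in above A c, g n <= n & g (g n) = g n],
      {in above A c &, {homo g : m n / m <= n}},
      forall n, n \in above A c ->
        leveled False F (fun m => (h m).-1) [fset m in above A c | g m == g n] &
      forall t, c < t -> #|` below [fset g n | n in above A c] t| <= beta t].

Lemma cuttable_last c (beta : nat -> nat) : c \in A ->
  leveled False F (fun m => (h m).-1) (above A c) ->
  (forall t, c < t -> 0 < beta t) -> cuttable c beta.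
Proof.
move=> cA lc b0; exists (fun=> c); split=> //.
- by move=> n; rewrite !in_above cA leqnn => /andP[].
- move=> n _; apply: leveled_sub lc => //.
  by apply/fsubsetP => m; rewrite in_fibre => /andP[].
- move=> t ct; apply: leq_trans (b0 _ ct); rewrite -(cardfs1 c).
  apply: fsubset_leq_card; apply/fsubsetP => a.
  by rewrite in_below inE => /andP[/imfsetP[n _ ->]].
Qed.

(** The points from [c] up to [c'] get the label [c]; the strict inequality between the budgets pays
    for this cut. *)
Lemma cuttable_step c c' (beta beta' : nat -> nat) : c \in A -> c < c' ->
  leveled False F (fun m => (h m).-1) (below (above A c) c') ->
  cuttable c' beta' -> (forall t, c < t -> 0 < beta t) ->
  (forall t, c' < t -> beta' t < beta t) -> cuttable c beta.
Proof.
move=> cA cc' lI [g [gA gm lg gb]] b0 bb.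
have up n : n \in above A c -> c' <= n -> n \in above A c'.
  by rewrite !in_above => /andP[-> _].
have dn n : n \in above A c' -> n \in above A c.
  by rewrite !in_above => /andP[-> ]; lia.
have ge n : n \in above A c -> c' <= n -> c' <= g n.
  by move=> nA cn; have [] := gA _ (up _ nA cn); rewrite in_above => /andP[].
exists (fun n => if n < c' then c else g n); split.
- move=> n nA; case: (ltnP n c') => nc'.
    rewrite cc'; split=> //; first by rewrite in_above cA leqnn.
    by move: nA; rewrite in_above => /andP[].
  have [gnA gn ggn] := gA _ (up _ nA nc').
  by rewrite ltnNge ge //=; split=> //; apply: dn.
- move=> m n mA nA mn; case: (ltnP m c') => mc'; case: (ltnP n c') => nc' //.
  + by have := ge _ nA nc'; lia.
  + lia.
  + by apply: gm => //; apply: up.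
- move=> n nA; case: (ltnP n c') => nc'.
    apply: leveled_sub lI => //; apply/fsubsetP => m; rewrite in_fibre in_below.
    case/andP=> mA; rewrite mA; case: ltnP => // mc' /eqP e.
    by have := ge _ mA mc'; rewrite e; lia.
  apply: leveled_sub (lg _ (up _ nA nc')) => //.
  apply/fsubsetP => m; rewrite !in_fibre => /andP[mA].
  have := ge _ nA nc'; case: ltnP => [_ gn /eqP e|mc' _ ->].
    by move: gn; rewrite -e; lia.
  by have := up m; rewrite !in_above mA mc' => ->.
- move=> t ct.
  have sub : below [fset (if n < c' then c else g n) | n in above A c] t
      `<=` c |` below [fset g n | n in above A c'] t.
    apply/fsubsetP => a; rewrite in_below in_fset1U in_below.
    case/andP=> /imfsetP[n /= nA ->] ->.
    case: ltnP => nc'; first by rewrite eqxx.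
    by rewrite andbT; apply/orP; right; apply/imfsetP; exists n => //=; apply: up.
  apply: leq_trans (fsubset_leq_card sub) _; rewrite cardfsU1.
  case: (leqP t c') => tc'; last first.
    have := gb _ tc'; have := bb _ tc'.
    have := leq_b1 (c \notin below [fset g n | n in above A c'] t).
    lia.
  rewrite (_ : below [fset g n | n in above A c'] t = fset0).
    by rewrite cardfs0 addn0; apply: leq_trans (leq_b1 _) (b0 _ ct).
  apply/fsetP => a; rewrite in_below in_fset0; apply/negP => /andP[/imfsetP[n /= nA ->]].
  by have [] := gA _ nA; rewrite in_above => /andP[_]; lia.
Qed.

(** Here a level is gained: what is left in [B] of the second generation becomes the first
    generation of a tree on [B]. *)
Lemma leveled_interval B : B `<=` A -> (forall n, n \in B -> 1 < h n) ->
  F (mins q B) -> leveled False F (fun m => (h m).-1) B.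
Proof.
move=> BA hB FB; move/fsubsetP: (BA) => BA'.
apply: (@leveled_classes _ _ _ q) => //.
- exact: posset_sub Ap.
- by move=> n /hB; lia.
- move=> n /BA' nA; apply: leveled_sub (lq nA) => //.
  by apply/fsubsetP => m; rewrite !in_fibre => /andP[/BA' -> ->].
Qed.

(** The least threshold at which [ok] fails is [c'.+1]. It exceeds [c.+1] because the single point
    [c] passes, and [c'] is in [A] because otherwise nothing would change there. *)
Lemma next_cut c : c \in A -> 1 < h c ->
  let ok B := (forall n, n \in B -> 1 < h n) /\ F (mins q B) in
  ok (above A c) \/ exists c', [/\ c' \in A, c < c', ok (below (above A c) c') &
    ~ ok (below (above A c) c'.+1)].
Proof.
move=> cA hc ok; have [all_ok|not_ok] := EM (forall t, ok (below (above A c) t)).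
  by left; have [t <-] := below_all (above A c); apply: all_ok.
right; have ext : exists t, `[< ~ ok (below (above A c) t) >].
  apply/not_existsP => H; apply: not_ok => t.
  by have := H t; rewrite asboolE => /contrapT.
case: (ex_minnP ext) => t /asboolP nt tmin.
have okc : ok (below (above A c) c.+1).
  have -> : below (above A c) c.+1 = [fset c].
    apply/fsetP => a; rewrite in_below in_above inE.
    by apply/idP/eqP => [|->]; [lia|rewrite cA; lia].
  split=> [n|]; first by rewrite inE => /eqP ->.
  apply: (@dom_closed_sub _ _ [fset c]) => //; first exact: mins_sub.
  by apply: F1; move/posset_fle: Ap; apply.
have ct : c.+1 < t.
  rewrite ltnNge; apply/negP => tc; apply: nt.
  have sub : below (above A c) t `<=` below (above A c) c.+1.
    by apply/fsubsetP => a; rewrite !in_below; lia.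
  case: okc => hB FB; split=> [n /(fsubsetP sub)/hB//|].
  have [->|/fset0Pn[a]] := eqVneq (below (above A c) t) fset0.
    by rewrite (_ : mins _ _ = fset0) //; apply: imfset0.
  rewrite in_below in_above => aB.
  by rewrite (_ : t = c.+1) //; lia.
case: t => // c' in nt tmin ct *; exists c'.
have okc' : ok (below (above A c) c').
  have [//|] := EM (ok (below (above A c) c')).
  by move=> /asboolP/tmin; rewrite ltnn.
split=> //; case: (boolP (c' \in A)) => // c'A; case: nt.
rewrite (_ : below (above A c) c'.+1 = below (above A c) c') //.
apply/fsetP => a; rewrite !in_below ltnS leq_eqVlt andb_orr.
case: eqP => [->|_]; last by rewrite andbF.
by rewrite in_above (negbTE c'A).
Qed.

(* The pieces of second generation coming from [U] that meet [c, oo) fit in one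
   piece of the first generation. *)
Let absorbed U c := forall S, S `<=` above A c -> (forall n, n \in S -> p n \in U) ->
  exists E, [/\ F E, exists2 e, e \in E & e <= c & dom 1 (mins q S) E].

Lemma absorbed_mono U c c' : c <= c' -> absorbed U c -> absorbed U c'.
Proof.
move=> cc' aU S SA SU; have [|E [FE [e eE ec] dE]] := aU S _ SU.
  apply: fsubset_trans SA _.
  by apply/fsubsetP => a; rewrite !in_above => /andP[-> ]; lia.
by exists E; split=> //; exists e => //; lia.
Qed.

Lemma mins_fibre S m : m \in A -> S `<=` A -> (forall n, n \in S -> p n = p m) ->
  dom 1 (mins q S) [fset q n | n in [fset n in A | p n == p m]].
Proof.
move=> mA /fsubsetP SA Sm; apply: (@dom_inj q); first exact: mins_inj.
  move=> c /minsP[cS _]; apply/imfsetP; exists c => //=.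
  by rewrite in_fibre SA //= Sm.
by move=> c /minsP[/SA/qA[]].
Qed.

(** The part of [S] over [U] is dominated by a member of [F] by assumption, the part over [m] by the
    children of [m], among which [q m <= c]. As [[c, c']] is not in [F], [union_lower] fits both
    into one member. *)
Lemma absorb m U c c' : m \in A -> p m = m -> m <= c -> c <= c' -> 0 < c ->
  ~ F (seg c c'.+1) -> absorbed U c -> absorbed (m |` U) c'.
Proof.
move=> mA pm mc cc' c0 nseg aU S SA SU.
pose S1 := [fset n in S | p n \in U]; pose S2 := [fset n in S | p n == m].
have sub i : i `<=` S -> i `<=` above A c'.
  by move=> iS; apply: fsubset_trans SA.
have S1S : S1 `<=` S by apply/fsubsetP => a; rewrite in_fibre => /andP[].
have S2S : S2 `<=` S by apply/fsubsetP => a; rewrite in_fibre => /andP[].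
have flem B : B `<=` S -> fle c' (mins q B).
  move=> BS; apply: fle_sub (fsubset_trans (mins_sub _ _) (sub _ BS)) _.
  exact: fle_above.
have [|n|E1 [FE1 h1 d1]] := aU S1.
- apply: fsubset_trans (sub _ S1S) _.
  by apply/fsubsetP => a; rewrite !in_above => /andP[-> ]; lia.
- by rewrite in_fibre => /andP[].
have d2 : dom 1 (mins q S2) [fset q n | n in [fset n in A | p n == p m]].
  apply: mins_fibre => //; last first.
    by move=> n; rewrite in_fibre pm => /andP[_ /eqP].
  exact: fsubset_trans (sub _ S2S) (above_sub _ _).
have h2 : exists2 e, e \in [fset q n | n in [fset n in A | p n == p m]] & e <= c.
  exists (q m); last by have [_ qm _] := qA mA; lia.
  by apply/imfsetP; exists m => //=; rewrite in_fibre mA eqxx.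
have [E [FE hE dE]] := union_lower c0 cc' nseg FE1 (Fq mA) h1 h2 d1 d2
  (flem _ S1S) (flem _ S2S).
exists E; split=> //; apply: dom_sub dE; apply/fsubsetP => x /minsP[xS xe].
have xmin B : B `<=` S -> x \in B -> x \in mins q B.
  move=> /fsubsetP BS xB; apply/minsP; split=> //; have [_ _ xle] := cminP q xS.
  have [cB qc cle] := cminP q xB; apply/eqP; rewrite eqn_leq cle //=.
  by rewrite -[leqLHS]xe; apply: xle => //; apply: BS.
rewrite in_fsetU; have := SU _ xS; rewrite in_fset1U => /orP[pxm|pxU].
  by rewrite [X in _ || X]xmin ?orbT // in_fibre xS.
by rewrite xmin // in_fibre xS.
Qed.

Definition leaves c := [fset n in above A c | h n <= 1].

Lemma in_leaves c n : (n \in leaves c) = [&& n \in A, c <= n & h n <= 1].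
Proof. by rewrite in_fibre ?in_above -andbA. Qed.

Lemma leaves_sub c c' t : c <= c' -> below (leaves c') t `<=` below (leaves c) t.
Proof.
move=> cc'; apply: below_mono; apply/fsubsetP => a.
by rewrite !in_leaves => /and3P[-> ? ->]; rewrite andbT; lia.
Qed.

(* The greedy cutting at [c]: a cut is forced at a leaf and just after it, or
   when the next point would make the pieces of second generation leave [F].
   Two consecutive cuts of the second kind absorb a new element of [V]; [e]
   records that the first of the two has been made. *)
Lemma greedy k : forall c U V (e : bool), #|` above A c| <= k -> c \in A ->
  absorbed U c -> (forall v, v \in V -> v \in A /\ p v = v) ->
  (if e then exists m, [/\ m \in A, p m = m, m <= c &
       forall n, n \in A -> 1 < h n -> p n \in m |` (U `|` V)]
   else forall n, n \in A -> 1 < h n -> p n \in U `|` V) ->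
  cuttable c (fun t => (1 < h c) + 2 * #|` below (leaves c) t| + e
                       + 2 * #|` below V t|).
Proof.
(* The budget: each leaf pays for the cut at it and the one just after it, each element of [V] for a
   pair of greedy cuts, [e] for the outstanding second cut of a pair, and [1 < h c] for the cut at
   [c] when [c] is not a leaf. *)
elim: k => [|k IH] c U V e ck cA aU VA cov.
  have : c \in above A c by rewrite in_above cA leqnn.
  by move: ck; rewrite leqn0 cardfs_eq0 => /eqP ->; rewrite in_fset0.
have rec_card c' : c < c' -> #|` above A c'| <= k.
  move=> cc'; rewrite -ltnS; apply: leq_trans ck.
  apply: fproper_ltn_card; rewrite fproperEneq.
  have sub : above A c' `<=` above A c.
    by apply/fsubsetP => a; rewrite !in_above => /andP[->]; lia.
  rewrite sub andbT; apply/negP => /eqP/fsetP/(_ c).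
  by rewrite !in_above cA leqnn; lia.
have c0 : 0 < c by move/posset_fle: Ap; apply.
have same c' : c < c' -> c' \in A ->
    cuttable c' (fun t => (1 < h c') + 2 * #|` below (leaves c') t| + e
                       + 2 * #|` below V t|).
  move=> cc' c'A; apply: (IH c' U V e) => //.
  - exact: rec_card.
  - by apply: absorbed_mono aU; apply: ltnW.
  - case: e cov => // -[m [mA pm mc cov]].
    by exists m; split=> //; lia.
(* A leaf [c] forms a piece alone, and the next cut is at the next point of [A]. *)
case: (leqP (h c) 1) => hc.
  have cL t : c < t -> c \in below (leaves c) t.
    by move=> ct; rewrite in_below in_leaves cA leqnn hc.
  have pos t : c < t -> 0 < #|` below (leaves c) t|.
    by move=> /cL ct; rewrite cardfs_gt0; apply/fset0Pn; exists c.
  have [e0|n0] := eqVneq (above A c.+1) fset0.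
    apply: cuttable_last => //; last by move=> t /pos; lia.
    rewrite (_ : above A c = [fset c]); first exact: leveled_leaf.
    apply/fsetP => a; move/fsetP: e0 => /(_ a); rewrite !in_above in_fset0 in_fset1.
    by case: eqP => [->|]; rewrite ?cA ?leqnn //; case: (a \in A) => //=; lia.
  have [c'A c'le] := fminP n0; move: (fmin _) c'A c'le => c'.
  rewrite in_above => /andP[c'A cc'] c'le.
  apply: (cuttable_step (c' := c') cA cc' _ (same _ cc' c'A)).
  - rewrite (_ : below _ _ = [fset c]); first exact: leveled_leaf.
    apply/fsetP => a; rewrite in_below in_above inE.
    case: eqP => [->|ne]; first by rewrite cA leqnn.
    apply/negP => /andP[/andP[aA ca] ac'].
    have : a \in above A c.+1 by rewrite in_above aA; lia.
    by move=> /c'le; lia.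
  - by move=> t /pos; lia.
  - move=> t c't; have ct := ltn_trans cc' c't.
    suff : #|` below (leaves c') t| < #|` below (leaves c) t|.
      by have := leq_b1 (1 < h c'); lia.
    rewrite (cardfsD1 c (below (leaves c) t)) cL // ltnS.
    apply: fsubset_leq_card; apply/fsubsetP => a; rewrite in_fsetD1 => aL.
    rewrite (fsubsetP (leaves_sub _ (ltnW cc')) _ aL) andbT.
    by move: aL; rewrite in_below in_leaves; lia.
have bpos t : c < t -> 0 < true + 2 * #|` below (leaves c) t| + e + 2 * #|` below V t|.
  by move=> _; lia.
case: (next_cut cA hc) => [[h2 Fm]|[c' [c'A cc' [h2 Fm] nok]]].
  apply: cuttable_last => //; apply: leveled_interval => //; exact: above_sub.
have lI : leveled False F (fun m => (h m).-1) (below (above A c) c').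
  apply: leveled_interval => //.
  exact: fsubset_trans (below_sub _ _) (above_sub _ _).
have Lle t := fsubset_leq_card (leaves_sub t (ltnW cc')).
(* A cut forced by the leaf [c'] leaves [U], [V] and [e] alone; the budget drops because [1 < h c']
   vanishes. *)
case: (leqP (h c') 1) => hc'.
  apply: (cuttable_step (c' := c') cA cc' lI (same _ cc' c'A)) => // t _.
  by have := Lle t; move: hc'; case: (leqP (h c') 1) => // _ _; lia.
set Q := below (above A c) c'.+1 in nok.
have Q2 n : n \in Q -> 1 < h n.
  rewrite in_below ltnS leq_eqVlt => /andP[nc /orP[/eqP -> //|nc']].
  by apply: h2; rewrite in_below nc.
have QA : Q `<=` above A c by apply: below_sub.
have nFQ : ~ F (mins q Q) by move=> FQ; apply: nok; split.
case: e cov same bpos => cov same bpos.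
  (* Second greedy cut of a pair: the minima collected from [c] to [c'] are not in [F], hence
     neither is [[c, c']], and [m] can join [U]. *)
  have [m [mA pm mc {}cov]] := cov.
  have nseg : ~ F (seg c c'.+1).
    move=> Fs; apply: nFQ; apply: dom_closed_sub Fs => //.
    apply: fsubset_trans (mins_sub _ _) _; apply/fsubsetP => a.
    by rewrite in_below in_above in_seg; lia.
  have aU' : absorbed (m |` U) c' by apply: absorb aU => //; apply: ltnW.
  have rec : cuttable c' (fun t => (1 < h c') + 2 * #|` below (leaves c') t| + false
                       + 2 * #|` below V t|).
    apply: (IH c' (m |` U) V false) => //; first exact: rec_card.
    by move=> n nA hn; rewrite -fsetUA cov.
  apply: (cuttable_step (c' := c') cA cc' lI rec) => // t _.
  by have := Lle t; have := leq_b1 (1 < h c'); lia.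
(* First greedy cut of a pair: without an element of [V] up to [c'], all points of [Q] would come
   from [U], and absorption would put [mins q Q] in [F]. The [v] found pays for both cuts and
   becomes the pending [m]. *)
have [v vV vc'] : exists2 v, v \in V & v <= c'.
  apply: contrapT => nv; apply: nFQ.
  have [//|n nQ|E [FE _ dE]] := aU Q; last exact: Fd FE.
  have nA : n \in A by apply: (fsubsetP (fsubset_trans QA (above_sub _ _))).
  have := cov _ nA (Q2 _ nQ); rewrite in_fsetU => /orP[//|pV].
  case: nv; exists (p n) => //; have [_ pn _] := pA nA.
  by move: nQ; rewrite in_below; lia.
have [vA pv] := VA _ vV.
have rec : cuttable c' (fun t => (1 < h c') + 2 * #|` below (leaves c') t| + true
                       + 2 * #|` below (V `\ v) t|).
  apply: (IH c' U (V `\ v) true) => //.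
  - exact: rec_card.
  - by apply: absorbed_mono aU; apply: ltnW.
  - by move=> w; rewrite in_fsetD1 => /andP[_ /VA].
  - exists v; split=> // n nA hn; rewrite in_fset1U in_fsetU in_fsetD1.
    have := cov _ nA hn; rewrite in_fsetU => /orP[->|->]; first by rewrite orbT.
    by case: eqP => //; rewrite !orbT.
apply: (cuttable_step (c' := c') cA cc' lI rec) => // t c't.
have vt : v \in below V t by rewrite in_below vV; lia.
have := cardfsD1 v (below V t); rewrite vt.
rewrite (_ : below V t `\ v = below (V `\ v) t); last first.
  by apply/fsetP => a; rewrite in_below !in_fsetD1 in_below andbA.
by have := Lle t; have := leq_b1 (1 < h c'); lia.
Qed.

(** Apply [greedy] at the least point of [A]. The minima of the first generation are the leaves of
    depth at most one together with [V], so the budget is at most twice their count. *)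
Lemma cuts : exists g,
  [/\ forall n, n \in A -> [/\ g n \in A, g n <= n & g (g n) = g n],
      {in A &, {homo g : m n / m <= n}},
      forall n, n \in A ->
        leveled False F (fun m => (h m).-1) [fset m in A | g m == g n] &
      multiplied 2 F [fset g n | n in A]].
Proof.
have [A0|A0] := eqVneq A fset0.
  exists id; rewrite A0; split=> //; exists fset0 => //.
  by move=> t; rewrite imfset_id leq_pmull.
have [cA cle] := fminP A0; move: (fmin A) cA cle => c cA cle.
have AE : above A c = A by apply: fle_aboveE.
pose M := [fset p n | n in A]; pose V := [fset m in M | 1 < h m].
have MP m : m \in M -> m \in A /\ p m = m.
  by case/imfsetP => n /= /pA[pnA _ ppn] ->.
have VP v : v \in V -> v \in A /\ p v = v by rewrite in_fibre => /andP[/MP].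
have covV n : n \in A -> 1 < h n -> p n \in V.
  move=> nA hn; have [pnA _ ppn] := pA nA.
  rewrite in_fibre; apply/andP; split; first by apply/imfsetP; exists n.
  rewrite ltnNge; apply/negP => hp.
  by move: hn; rewrite (leafA nA pnA hp (esym ppn)) ltnNge hp.
have LM : leaves c `<=` M.
  apply/fsubsetP => n; rewrite in_leaves => /and3P[nA _ hn].
  have [pnA _ ppn] := pA nA; apply/imfsetP; exists n => //=.
  exact/esym/(leafA pnA nA hn).
have cardM t : #|` below M t| = #|` below (leaves c) t| + #|` below V t|.
  rewrite -cardfsUI (_ : _ `&` _ = fset0) ?cardfs0 ?addn0.
    congr (#|` _|); apply/fsetP => a; rewrite in_fsetU !in_below in_leaves in_fibre.
    case: (boolP (a \in M)) => aM /=.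
      have [aA _] := MP a aM; rewrite aA cle //=.
      by case: (leqP (h a) 1); case: (a < t).
    rewrite orbF; apply/esym/negP => /andP[aL _].
    by move: aM; rewrite (fsubsetP LM) // in_leaves.
  by apply/fsetP => a; rewrite in_fsetI !in_below in_leaves in_fibre in_fset0; lia.
suff [g [gA gm lg gb]] : cuttable c (fun t => 2 * #|` below M t|).
  exists g; rewrite -AE; split=> //; exists M => // t.
  case: (leqP t c) => tc; last exact: gb.
  rewrite (_ : below _ t = fset0) ?cardfs0 //.
  apply/fsetP => a; rewrite in_below in_fset0; apply/negP => /andP[/imfsetP[n /= nA ->]].
  by have [] := gA _ nA; rewrite in_above => /andP[_]; lia.
have weak U V' : absorbed U c -> (forall v, v \in V' -> v \in A /\ p v = v) ->
    (forall n, n \in A -> 1 < h n -> p n \in U `|` V') ->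
    (forall t, c < t -> (1 < h c) + 2 * #|` below V' t| <= 2 * #|` below V t|) ->
    cuttable c (fun t => 2 * #|` below M t|).
  move=> aU V'P cov le.
  have [g [gA gm lg gb]] := @greedy _ c U V' false (leqnn _) cA aU V'P cov.
  exists g; split=> // t ct; apply: leq_trans (gb _ ct) _.
  by have := le _ ct; rewrite cardM; lia.
have c0 : 0 < c by move/posset_fle: Ap; apply.
case: (leqP (h c) 1) => hc.
  apply: (weak fset0 V) => //; last by move=> t _; rewrite ltnNge hc.
    move=> S _ SU; exists [fset c]; split; first exact: F1.
      by exists c => //; rewrite inE.
    apply/sub_dom/fsubsetP => x /minsP[/SU]; rewrite in_fset0 //.
  by move=> n nA hn; rewrite fset0U covV.
have [pcA pc _] := pA cA.
have pcc : p c = c by have := cle _ pcA; lia.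
have cV : c \in V by rewrite -{1}pcc covV.
(* A first point [c] that is not a leaf starts absorbed, because its children form a member of [F];
   taking it out of [V] compensates for the term [1 < h c]. *)
apply: (weak [fset c] (V `\ c)).
- move=> S SA SU; exists [fset q n | n in [fset n in A | p n == p c]].
  split; first exact: Fq.
    exists (q c); last by have [] := qA cA.
    by apply/imfsetP; exists c => //=; rewrite in_fibre cA eqxx.
  apply: mins_fibre => //; first by rewrite -AE.
  by move=> n /SU; rewrite inE pcc => /eqP.
- by move=> v; rewrite in_fsetD1 => /andP[_ /VP].
- move=> n nA hn; rewrite in_fsetU in_fsetD1 inE covV // andbT.
  by rewrite orbN.
- move=> t ct; have ct' : c \in below V t by rewrite in_below cV.
  have := cardfsD1 c (below V t); rewrite ct'.
  rewrite (_ : below V t `\ c = below (V `\ c) t); last first.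
    by apply/fsetP => a; rewrite in_below !in_fsetD1 in_below andbA.
  by rewrite hc; lia.
Qed.

End Cuts.

(** The induction is on a uniform bound for the depths, because the pieces produced by [cuts] are
    not subtrees of the given tree. *)
Lemma leveled_monotone F h A : dom_closed F -> (forall n, 0 < n -> F [fset n]) ->
  (forall b c E1 E2 D1 D2, 0 < b -> ~ F (seg b c.+1) -> F E1 -> F E2 ->
   (exists2 e, e \in E1 & e <= b) -> (exists2 e, e \in E2 & e <= b) ->
   dom 1 D1 E1 -> dom 1 D2 E2 -> fle c D1 -> fle c D2 -> F (D1 `|` D2)) ->
  leveled False F h A -> leveled True (multiplied 2 F) h A.
Proof.
move=> Fd F1 Fu lA.
have F0 : F fset0 := dom_closed0 Fd (F1 _ (ltn0Sn 0)).
have F20 : multiplied 2 F fset0.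
  by exists fset0 => // t; rewrite leq_pmull.
have [K hK] : exists K, forall n, n \in A -> h n <= K.
  by exists (\max_(n <- A) h n) => n nA; apply: (@leq_bigmax_seq _ _ _ h).
elim: K h A lA hK => [|K IH] h A lA hK.
  case: lA hK => {h A} [h n n0|h A p Ap h0 _ _ _ _] hK; first exact: leveled_leaf.
  rewrite (_ : A = fset0); first exact: leveled0.
  apply/fsetP => n; rewrite in_fset0; apply/negP => nA.
  by have := h0 _ nA; have := hK _ nA; lia.
case: lA hK => {h A} [h n n0|h A p Ap h0 pA _ FA lA] hK; first exact: leveled_leaf.
have /choice[Q QP] : forall c, exists q, c \in A ->
    [/\ forall n, n \in [fset m in A | p m == p c] ->
          q n \in [fset m in A | p m == p c] /\ q n <= n,
      F [fset q n | n in [fset m in A | p m == p c]],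
      forall n, n \in [fset m in A | p m == p c] ->
        leveled False F (fun m => (h m).-2)
          [fset m in [fset m in A | p m == p c] | q m == q n] &
      forall n, n \in [fset m in A | p m == p c] -> (h n).-1 = 0 ->
        [fset m in A | p m == p c] = [fset n]].
  move=> c; case: (boolP (c \in A)) => [cA|_]; last by exists id.
  by have [q qP] := leveled_children Fd F1 (lA _ cA); exists q.
(* The second generation, glued from the children of each first-generation piece. *)
pose q n := Q (p n) n.
have self n : n \in A -> n \in [fset m in A | p m == p (p n)].
  by move=> nA; have [_ _ ppn] := pA n nA; rewrite in_fibre nA ppn eqxx.
have qA n : n \in A -> [/\ q n \in A, q n <= n & p (q n) = p n].
  move=> nA; have [pnA _ ppn] := pA n nA; have [+ _ _ _] := QP _ pnA.
  move=> /(_ _ (self _ nA)); rewrite in_fibre ppn => -[/andP[qnA /eqP pq] qn].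
  by split.
have fibE n : n \in A -> [fset m in A | p m == p (p n)] = [fset m in A | p m == p n].
  by move=> nA; have [_ _ ->] := pA n nA.
have [|||g [gA gm lg Fg]] := @cuts F Fd F1 Fu A h p q Ap pA qA _ _ _ FA.
- move=> n nA; have [pnA _ ppn] := pA n nA; have [_ + _ _] := QP _ pnA.
  rewrite fibE // (_ : [fset q m | m in _] =
    [fset Q (p n) m | m in [fset m in A | p m == p n]]) //.
  apply: eq_in_imfset => m; rewrite in_fibre => /andP[_ /eqP pm].
  by rewrite /q pm.
- move=> n nA; have [pnA _ ppn] := pA n nA; have [_ _ + _] := QP _ pnA.
  move=> /(_ _ (self _ nA)); apply: leveled_sub => //.
  apply/fsubsetP => m; rewrite !in_fibre => /andP[mA /eqP qmn].
  have pmn : p m = p n.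
    by have [_ _ <-] := qA m mA; have [_ _ <-] := qA n nA; rewrite qmn.
  by rewrite mA ppn pmn eqxx -/(q n) -qmn /q pmn eqxx.
- move=> m n mA nA hn pmn; have [pnA _ ppn] := pA n nA.
  have [_ _ _ /(_ n (self _ nA))] := QP _ pnA.
  have -> : (h n).-1 = 0 by lia.
  by move=> /(_ erefl)/fsetP/(_ m); rewrite in_fibre mA pmn ppn eqxx inE => /esym/eqP.
apply: (@leveled_node _ _ _ _ g) => // n nA; apply: IH; first exact: lg.
by move=> m; rewrite in_fibre => /andP[/hK + _]; lia.
Qed.

End Trees.

(** * Indexed decompositions and the family [F[A_2]] *)

Section Families.
Local Open Scope fset_scope.
Local Open Scope nat_scope.
Implicit Types (A B C X : {fset nat}) (F : {fset nat} -> Prop) (h p q : nat -> nat).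

Definition decomposition (mono : Prop) F k (E : 'I_k -> {fset nat}) :=
  [/\ forall i, E i != fset0 /\ posset (E i),
      forall i j, i != j -> [disjoint E i & E j]%fset,
      mono -> successive E & F (set_of_mins E)].

Lemma admissible_decomposition F k (E : 'I_k -> {fset nat}) :
  admissible F E <-> decomposition True F E.
Proof.
split=> [[E0 Es FE]|[E0 _ Es FE]]; split=> //; last exact: Es.
move=> i j ij; apply/fdisjointP => a ai; apply/negP => aj.
move: ij; rewrite -val_eqE neq_ltn => /orP[ij|ji].
  by have := Es _ _ ij _ _ ai aj; rewrite ltnn.
by have := Es _ _ ji _ _ aj ai; rewrite ltnn.
Qed.

Lemma allowable_decomposition F k (E : 'I_k -> {fset nat}) :
  allowable F E <-> decomposition False F E.
Proof. by split=> [[E0 Ed FE]|[E0 Ed _ FE]]; split. Qed.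

(** Listing the values of [p] in increasing order orders the fibres by their minima, so they are
    successive when [p] is monotone. *)
Lemma fibre_decomposition mono F A p (R : nmodType) : posset A ->
  (forall n, n \in A -> [/\ p n \in A, p n <= n & p (p n) = p n]) ->
  (mono -> {in A &, {homo p : m n / m <= n}}) ->
  F [fset p n | n in A] ->
  exists k (E : 'I_k -> {fset nat}), [/\ decomposition mono F E,
    forall i, (exists2 n, n \in A & E i = [fset m in A | p m == p n]),
    forall n, n \in A -> exists i, n \in E i &
    forall f : {fset nat} -> R, (\sum_(i < k) f (E i) =
      \sum_(c <- [fset p n | n in A]) f [fset m in A | p m == c])%R].
Proof.
move=> Ap pA pm FA; pose s := sort leq [fset p n | n in A].
pose E (i : 'I_(size s)) := [fset m in A | p m == nth 0 s i].
have sP c : c \in s -> c \in A /\ p c = c.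
  by rewrite mem_sort => /imfsetP[n /= /pA[pnA _ ppn] ->].
have iP (i : 'I_(size s)) : nth 0 s i \in A /\ p (nth 0 s i) = nth 0 s i.
  by apply: sP; apply: mem_nth.
have us : uniq s by rewrite sort_uniq fset_uniq.
have minE i : fmin (E i) = nth 0 s i.
  have [cA pc] := iP i; apply: fmin_eq; first by rewrite in_fibre cA pc eqxx.
  by move=> a; rewrite in_fibre => /andP[/pA[_ + _] /eqP <-].
have minsE : set_of_mins E = [fset p n | n in A].
  apply/fsetP => c; apply/imfsetP/idP => [[i _ ->]|cA].
    by rewrite minE -(mem_sort leq) mem_nth.
  have cs : c \in s by rewrite mem_sort.
  have ic : index c s < size s by rewrite index_mem.
  by exists (Ordinal ic) => //; rewrite minE nth_index.
have ss : sorted ltn s.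
  by rewrite ltn_sorted_uniq_leq us; apply: sort_sorted; apply: leq_total.
exists (size s), E; split.
- split.
  + move=> i; have [cA pc] := iP i; split.
      by apply/fset0Pn; exists (nth 0 s i); rewrite in_fibre cA pc eqxx.
    by apply: posset_sub Ap; apply/fsubsetP => a; rewrite in_fibre => /andP[].
  + move=> i j ij; apply/fdisjointP => a; rewrite !in_fibre => /andP[aA /eqP ->].
    by rewrite aA /= nth_uniq.
  + move=> /pm{}pm i j ij a b; rewrite !in_fibre.
    move=> /andP[aA /eqP pa] /andP[bA /eqP pb].
    rewrite ltnNge; apply/negP => /(pm _ _ bA aA); rewrite pa pb leqNgt.
    by rewrite (sorted_ltn_nth ltn_trans) // ?inE //.
  + by rewrite minsE.
- by move=> i; have [cA pc] := iP i; exists (nth 0 s i); rewrite // pc.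
- move=> n nA; have ps : p n \in s by rewrite mem_sort; apply/imfsetP; exists n.
  have ip : index (p n) s < size s by rewrite index_mem.
  by exists (Ordinal ip); rewrite in_fibre nA /= nth_index.
- move=> f; rewrite -(perm_big _ (permEl (perm_sort leq _))) /= -/s.
  by rewrite (big_nth 0) big_mkord.
Qed.

(** Pair the elements of [C] in increasing order. The minima of the pairs have even rank, counted
    from 0, so below [t] there are at most half as many as in [C], rounded up, hence at most as many
    as in [A]. *)
Lemma multiplied_compose F C : dom_closed F -> posset C ->
  multiplied 2 F C -> set_compose F (card_le_family 2) C.
Proof.
move=> Fd Cp [A FA CA]; pose s : seq nat := sort leq C.
have us : uniq s by rewrite sort_uniq fset_uniq.
have ss : sorted ltn s.
  by rewrite ltn_sorted_uniq_leq us; apply: sort_sorted; apply: leq_total.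
have sC c : (c \in s) = (c \in C) by rewrite mem_sort.
pose r n := index n s; pose p n := nth 0 s (r n)./2.*2.
have r_lt n : n \in C -> r n < size s by rewrite -sC index_mem.
have half_le n : (r n)./2.*2 <= r n by rewrite -{2}(odd_double_half (r n)) leq_addl.
have half_lt n : n \in C -> (r n)./2.*2 < size s.
  by move=> /r_lt; apply: leq_ltn_trans.
have nth_le i j : i <= j -> j < size s -> nth 0 s i <= nth 0 s j.
  move=> ij js; move: ij; rewrite leq_eqVlt => /orP[/eqP -> //|ij].
  by apply/ltnW/(sorted_ltn_nth ltn_trans) => //; rewrite inE //; lia.
have nth_r n : n \in C -> nth 0 s (r n) = n by rewrite -sC; apply: nth_index.
have r_p n : n \in C -> r (p n) = (r n)./2.*2.
  by move=> nC; rewrite /r /p index_uniq // half_lt.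
have pC n : n \in C -> [/\ p n \in C, p n <= n & p (p n) = p n].
  move=> nC; split; first by rewrite -sC mem_nth // half_lt.
    by rewrite -{2}(nth_r n nC) nth_le // r_lt.
  by rewrite {1}/p r_p // doubleK.
have r_mono m n : m \in C -> n \in C -> m <= n -> r m <= r n.
  move=> mC nC mn; rewrite leqNgt; apply/negP => rnm.
  have : nth 0 s (r n) < nth 0 s (r m).
    by apply/(sorted_ltn_nth ltn_trans) => //; rewrite inE; apply: r_lt.
  by rewrite !nth_r // ltnNge mn.
have pm : True -> {in C &, {homo p : m n / m <= n}}.
  move=> _ m n mC nC mn; apply: nth_le; last exact: half_lt.
  by rewrite leq_double half_leq // r_mono.
have FpC : F [fset p n | n in C].
  apply: Fd FA => t; rewrite mul1n.
  suff : #|` below [fset p n | n in C] t| <= uphalf #|` below C t|.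
    by have := CA t; rewrite uphalf_half; lia.
  rewrite -[leqRHS](size_iota 0).
  rewrite -(size_map (fun c => (r c)./2)); apply: uniq_leq_size.
    rewrite map_inj_in_uniq ?fset_uniq // => x y.
    rewrite !in_below => /andP[/imfsetP[m /= mC ->] _] /andP[/imfsetP[n /= nC ->] _].
    by rewrite !r_p // !doubleK /p => ->.
  move=> _ /mapP[c + ->]; rewrite in_below => /andP[/imfsetP[n /= nC cE] ct].
  have cC : c \in C by rewrite cE; case: (pC n nC).
  have rc : (r c).+1 <= #|` below C t|.
    have tk : size (take (r c).+1 s) = (r c).+1.
      by rewrite size_takel // r_lt.
    rewrite -tk; apply: uniq_leq_size; first exact: take_uniq.
    move=> a a_in; have aC : a \in C by rewrite -sC (mem_take a_in).
    rewrite in_below aC /=; apply: leq_ltn_trans ct.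
    have ra : r a <= r c by move: a_in; rewrite in_take ?sC.
    by rewrite -(nth_r _ aC) -(nth_r _ cC) nth_le // r_lt.
  by rewrite mem_iota add0n; apply: (@half_leq (r c).+2 #|` below C t|.+1).
have [k [E [Edec Efib Ecov _]]] := fibre_decomposition nat Cp pC pm FpC.
exists k, E; split; first exact/admissible_decomposition.
- move=> i; split; first by case: Edec => /(_ i)[].
  have [n nC ->] := Efib i; set D := [fset m in C | _].
  have sub : D `<=` [fset nth 0 s (r n)./2.*2; nth 0 s (r n)./2.*2.+1].
    apply/fsubsetP => m; rewrite in_fibre => /andP[mC /eqP pmn].
    have : (r m)./2.*2 = (r n)./2.*2 by rewrite -!r_p // pmn.
    move=> rmn; rewrite in_fset2 -(nth_r m mC).
    have := odd_double_half (r m); rewrite rmn.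
    by case: (odd _) => <-; rewrite ?add0n ?add1n eqxx ?orbT.
  apply: leq_trans (fsubset_leq_card sub) _; rewrite cardfs2; lia.
- apply/fsetP => a; apply/idP/in_funion => [aC|[i]]; last first.
    by have [n _ ->] := Efib i; rewrite in_fibre => /andP[].
  exact: Ecov.
Qed.
End Families.

(** * Norms defined by an implicit equation *)

Section ImplicitNorms.
Local Open Scope fset_scope.
Local Open Scope ring_scope.
Context {R : realType}.
Implicit Types (A B S : {fset nat}) (F : {fset nat} -> Prop) (x : nat -> R).
Variables (adm : forall k, ('I_k -> {fset nat}) -> Prop) (theta : R).
Variable N : (nat -> R) -> R.
Hypothesis theta_gt0 : 0 < theta.
Hypothesis theta_lt1 : theta < 1.
Hypothesis NP : implicit_norm adm theta N.

Lemma c00_restrict E x : c00 x -> c00 (coord_restrict E x).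
Proof.
move=> [x0 fx]; split; first by rewrite /coord_restrict x0 if_same.
apply: sub_finite_set fx => n /=; rewrite /coord_restrict.
by case: ifP => //; rewrite eqxx.
Qed.

Lemma norm_ge_coord x n : c00 x -> `|x n| <= N x.
Proof.
move=> cx; have [_ /(_ x cx) e] := NP.
rewrite -lee_fin e le_max; apply/orP; left.
by apply: ereal_sup_ubound; exists n.
Qed.

Lemma norm_ge_sum x k (E : 'I_k -> {fset nat}) : c00 x -> adm E ->
  theta * \sum_(i < k) N (coord_restrict (E i) x) <= N x.
Proof.
move=> cx aE; have [_ /(_ x cx) e] := NP.
rewrite -lee_fin e le_max; apply/orP; right.
rewrite EFinM lee_pmul2l //; apply: ereal_sup_ubound; exists k, E; split=> //.
Qed.

(** Otherwise [N x - eps] would bound both terms of the maximum, hence [N x] itself. *)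
Lemma norm_approx_cases x (eps : R) : c00 x -> 0 < eps ->
  (exists n, N x - eps < `|x n|) \/
  exists k (E : 'I_k -> {fset nat}), adm E /\
    N x - eps < theta * \sum_(i < k) N (coord_restrict (E i) x).
Proof.
move=> cx eps0; have [_ /(_ x cx) e] := NP.
have [?|/forallNP Hn] := EM (exists n, N x - eps < `|x n|); first by left.
right; apply: contrapT => HE.
suff : ((N x)%:E <= (N x - eps)%:E)%E by by rewrite lee_fin lerBrDr gerDl leNgt eps0.
rewrite {1}e ge_max; apply/andP; split.
  apply: ge_ereal_sup => _ [n _ <-]; rewrite lee_fin leNgt; apply/negP; exact: Hn.
apply: (@le_trans _ _ (theta%:E * ((N x - eps) / theta)%:E)%E); last first.
  by rewrite -EFinM mulrC divfK ?gt_eqF.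
rewrite lee_pmul2l //.
apply: ge_ereal_sup => _ [k [E [aE ->]]].
rewrite lee_fin ler_pdivlMr // mulrC leNgt; apply/negP => H.
by apply: HE; exists k, E.
Qed.

Lemma norm0 x : (forall n, x n = 0) -> N x = 0.
Proof.
move=> x0; have [nN _] := NP.
have c0 : c00 (fun=> 0 : R).
  split=> //; apply: sub_finite_set (finite_set0 _) => n /=.
  by rewrite eqxx.
have -> : x = (fun n => 0 * (fun=> 0) n) by apply/funext => n; rewrite x0 mul0r.
by rewrite (norm_c00Z nN) // normr0 mul0r.
Qed.

Definition leveled_sum (h : nat -> nat) A x : R :=
  \sum_(n <- A) theta ^+ h n * `|x n|.

Lemma leveled_sum_fset0 h x : leveled_sum h fset0 x = 0.
Proof. by rewrite /leveled_sum big_seq_fset0. Qed.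

(** Each node is one use of the implicit equation and contributes a factor [theta]; a leaf uses the
    supremum norm. *)
Lemma leveled_sum_le_norm (mono : Prop) F h A x :
  (forall k (E : 'I_k -> {fset nat}), decomposition mono F E -> adm E) ->
  leveled mono F h A -> c00 x -> leveled_sum h A x <= N x.
Proof.
move=> Fadm lA; elim: lA x => {h A} [h n n0|h A p Ap h0 pA pm FA _ IH] x cx.
  rewrite /leveled_sum big_seq_fset1; apply: le_trans (norm_ge_coord n cx).
  by rewrite ler_piMl // exprn_ile1 // ltW.
have [k [E [Edec Efib _ sumE]]] := fibre_decomposition R Ap pA pm FA.
apply: le_trans (norm_ge_sum cx (Fadm _ _ Edec)).
pose f B := leveled_sum (fun m => (h m).-1) B x.
have -> : leveled_sum h A x = theta * \sum_(i < k) f (E i).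
  rewrite sumE /leveled_sum (partition_big_imfset _ p) mulr_sumr /=.
  apply: eq_bigr => c _; rewrite /f /leveled_sum mulr_sumr big_fset_condE.
  apply: eq_big_seq => n; rewrite in_fibre => /andP[/h0 + _].
  by case: (h n) => // m _; rewrite exprS mulrA.
rewrite ler_pM2l //; apply: ler_sum => i _.
apply: le_trans (_ : _ <= leveled_sum (fun m => (h m).-1) (E i)
                              (coord_restrict (E i) x)) _.
  rewrite /f /leveled_sum le_eqVlt; apply/orP; left; apply/eqP.
  by apply: eq_big_seq => n nE; rewrite /coord_restrict nE.
by have [n nA ->] := Efib i; apply: IH => //; apply: c00_restrict.
Qed.

Lemma leveled_leq (mono : Prop) F h h' A : (forall n, n \in A -> (h n <= h' n)%N) ->
  leveled mono F h A -> leveled mono F h' A.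
Proof.
move=> + lA; elim: lA h' => {h A} [h n n0|h A p Ap h0 pA pm FA _ IH] h' hh'.
  exact: leveled_leaf.
apply: (@leveled_node _ _ _ _ p) => // [n nA|n nA].
  exact: leq_trans (h0 n nA) (hh' n nA).
by apply: IH => // m; rewrite in_fibre => /andP[/hh' + _]; lia.
Qed.

Lemma in_disjoint_funion k (E : 'I_k -> {fset nat}) n :
  (forall i j, i != j -> [disjoint E i & E j]) -> n \in funion E ->
  exists i, n \in E i /\ forall j, (n \in E j) = (j == i).
Proof.
move=> Ed /in_funion[i ni]; exists i; split=> // j.
apply/idP/eqP => [nj|-> //]; apply/eqP/negPn/negP => /Ed/fdisjointP/(_ _ nj).
by rewrite ni.
Qed.

Lemma sum_funion k (E : 'I_k -> {fset nat}) (f : nat -> R) :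
  (forall i j, i != j -> [disjoint E i & E j]) ->
  \sum_(n <- funion E) f n = \sum_(i < k) \sum_(n <- E i) f n.
Proof.
move=> Ed; transitivity (\sum_(n <- funion E) \sum_(i < k | n \in E i) f n).
  apply: eq_big_seq => n /(in_disjoint_funion Ed)[i [ni nE]].
  by rewrite (big_pred1 i).
rewrite (exchange_big_dep xpredT) //=; apply: eq_bigr => i _.
rewrite big_fset_condE; apply: eq_fbigl => n; rewrite in_fibre.
by apply/andP/idP => [[]//|ni]; split=> //; apply/in_funion; exists i.
Qed.

(** Points are labelled by the index of their piece, monotone when the pieces are successive;
    shrinking [E i] to [B i] only moves minima to the right. *)
Lemma leveled_glue (mono : Prop) F k (E B : 'I_k -> {fset nat})
    (hs : 'I_k -> nat -> nat) :
  dom_closed F -> decomposition mono F E -> (forall i, B i `<=` E i) ->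
  (forall i, leveled mono F (hs i) (B i)) ->
  exists2 h, leveled mono F h (funion B) &
    forall i n, n \in B i -> h n = (hs i n).+1.
Proof.
move=> Fd [E0 Ed Es FE] BE lB.
have Bd i j : i != j -> [disjoint B i & B j].
  move=> ij; apply/fdisjointP => n /(fsubsetP (BE i)) ni; apply/negP.
  by move=> /(fsubsetP (BE j)); apply/negP/(fdisjointP (Ed _ _ ij)).
have /choice[idx idxP] : forall n, exists i : option 'I_k, n \in funion B ->
    exists2 j, i = Some j & forall j', (n \in B j') = (j' == j).
  move=> n; case: (boolP (n \in funion B)) => [/(in_disjoint_funion Bd)[i [ni nB]]|_].
    by exists (Some i) => _; exists i.
  by exists None.
have idxB i n : n \in B i -> idx n = Some i.
  move=> ni; have [|j ej nj] := idxP n; first by apply/in_funion; exists i.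
  by rewrite ej; move: ni; rewrite nj => /eqP ->.
have idxU n : n \in funion B -> exists2 i, idx n = Some i & n \in B i.
  by move=> /in_funion[i ni]; exists i => //; apply: idxB.
pose q n := if idx n is Some i then nat_of_ord i else 0%N.
pose h n := if idx n is Some i then (hs i n).+1 else 0%N.
exists h; last by move=> i n /idxB; rewrite /h => ->.
apply: (@leveled_classes _ _ _ q).
- apply/negP => /in_funion[i /(fsubsetP (BE i)) i0].
  by have [_ /negP] := E0 i.
- by move=> n /idxU[i + _]; rewrite /h => ->.
- move=> /Es{}Es m n /idxU[i mi mB] /idxU[j nj nB] mn.
  rewrite /q mi nj leqNgt; apply/negP => ji.
  have := Es _ _ ji n m (fsubsetP (BE j) _ nB) (fsubsetP (BE i) _ mB).
  by rewrite ltnNge mn.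
- apply: Fd FE; apply: (@dom_inj (fun n => if idx n is Some i then fmin (E i) else 0%N)).
  + move=> c c' cm cm' e; apply: (mins_inj cm cm'); move: e.
    have [/idxU[i ci ciB] _] := minsP _ _ _ cm.
    have [/idxU[j cj cjB] _] := minsP _ _ _ cm'.
    rewrite /q ci cj => e; congr nat_of_ord; apply/eqP/negPn/negP => /Ed/fdisjointP.
    have [Ei _] := fminP (E0 i).1; have [Ej _] := fminP (E0 j).1.
    by move=> /(_ _ Ei); rewrite e Ej.
  + move=> c /minsP[/idxU[i -> ciB] _].
    by apply/imfsetP; exists i.
  + move=> c /minsP[/idxU[i -> ciB] _].
    by have [_] := fminP (E0 i).1; apply; apply: (fsubsetP (BE i)).
- move=> n /idxU[i ni nB].
  rewrite (_ : [fset m in _ | _] = B i).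
    by apply: leveled_leq (lB i) => m /idxB; rewrite /h => ->.
  apply/fsetP => m; rewrite in_fibre; apply/andP/idP => [[/idxU[j mj mB]]|mB].
    by rewrite /q mj ni => /eqP/ord_inj <-.
  by split; [apply/in_funion; exists i|rewrite /q ni (idxB _ _ mB)].
Qed.

(** Induction on the size of the support: the pieces of a nearly optimal decomposition meet strictly
    smaller parts of it, and the trees found for them are glued. *)
Lemma norm_approx (mono : Prop) F :
  dom_closed F -> F fset0 ->
  (forall k (E : 'I_k -> {fset nat}), adm E -> decomposition mono F E) ->
  forall x (eps : R), c00 x -> 0 < eps ->
  exists h A, leveled mono F h A /\ N x <= leveled_sum h A x + eps.
Proof.
move=> Fd F0 Fadm.
suff main s x S (eps : R) : c00 x -> (forall n, n \notin S -> x n = 0) ->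
    (#|` S| < s)%N -> 0 < eps ->
    exists h A, leveled mono F h A /\ N x <= leveled_sum h A x + eps.
  move=> x eps cx; have [x0 fx] := cx.
  apply: (main _ x (fset_set [set n | x n != 0]) eps cx _ (ltnSn _)) => n.
  by rewrite in_fset_set // notin_setE /= => /negP; rewrite negbK => /eqP.
elim: s x S eps => // s IH x S eps cx xS Ss eps0.
have triv : N x <= eps ->
      exists h A, leveled mono F h A /\ N x <= leveled_sum h A x + eps.
  move=> Ne; exists id, fset0; split; first exact: leveled0.
  by rewrite leveled_sum_fset0 add0r.
have [Nx|Nx] := lerP (N x) 0; first by apply: triv; apply: le_trans Nx (ltW eps0).
(* The first bound keeps half of the error for the pieces. The second excludes a piece containing
   the whole support, which would give only [theta * N x]. *)
pose eps1 := Num.min (eps / 2) ((1 - theta) * N x).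
have eps1_gt0 : 0 < eps1 by rewrite lt_min divr_gt0 //= mulr_gt0 // subr_gt0.
have eps1_le : eps1 <= eps / 2 by rewrite ge_min lexx.
have eps1_le' : eps1 <= (1 - theta) * N x by rewrite ge_min lexx orbT.
have eps2_le : eps / 2 <= eps by rewrite [leRHS](splitr eps) lerDl ltW // divr_gt0.
have [[n xn]|[k [E [aE sumE]]]] := norm_approx_cases cx eps1_gt0.
  case: (posnP n) xn => [->|n0] xn.
    apply: triv; move: xn; have [-> _] := cx; rewrite normr0 subr_lt0 => /ltW xn.
    exact: le_trans xn (le_trans eps1_le eps2_le).
  exists (fun=> 0%N), [fset n]; split; first exact: leveled_leaf.
  rewrite /leveled_sum big_seq_fset1 expr0 mul1r -lerBlDr.
  apply: le_trans (ltW xn); rewrite lerB //.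
  exact: le_trans eps1_le eps2_le.
have Edec := Fadm _ _ aE; have [E0 Ed _ _] := Edec.
have [[i Si]|/forallNP nS] := EM (exists i, S `<=` E i).
  exfalso; move: sumE; rewrite (bigD1 i) //= big1 => [|j ji]; last first.
    apply: norm0 => n; rewrite /coord_restrict; case: ifP => // nj.
    apply: xS; apply/negP => /(fsubsetP Si) ni.
    by have /fdisjointP/(_ _ nj) := Ed _ _ ji; rewrite ni.
  have -> : coord_restrict (E i) x = x.
    apply/funext => n; rewrite /coord_restrict; case: ifP => // /negbT nE.
    by apply/esym/xS/negP => /(fsubsetP Si); apply/negP.
  rewrite addr0 ltNge => /negP; apply.
  by rewrite lerBrDr -lerBrDl; apply: le_trans eps1_le' _; rewrite mulrBl mul1r.
(* The divisor is [k.+1] because [k] may be 0. *)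
pose eps2 : R := eps / 2 / k.+1%:R.
have eps2_gt0 : 0 < eps2 by rewrite !divr_gt0.
have /choice[HA HAP] : forall i : 'I_k, exists hA : (nat -> nat) * {fset nat},
    leveled mono F hA.1 hA.2 /\
    N (coord_restrict (E i) x) <= leveled_sum hA.1 hA.2 (coord_restrict (E i) x) + eps2.
  move=> i; have [|n nSE|||h [A hA]] := IH (coord_restrict (E i) x) (S `&` E i) eps2.
  - exact: c00_restrict.
  - rewrite /coord_restrict; case: ifP => // nE; apply: xS.
    by move: nSE; rewrite in_fsetI nE andbT.
  - rewrite -ltnS; apply: leq_trans Ss; rewrite ltnS.
    apply: fproper_ltn_card; rewrite fproperEneq fsubsetIl andbT.
    apply/negP => /eqP e; apply: (nS i); apply/fsetIidPl; exact: e.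
  - exact: eps2_gt0.
  - by exists (h, A).
pose B i := (HA i).2 `&` E i.
have BE i : B i `<=` E i by apply: fsubsetIr.
have lB i : leveled mono F (HA i).1 (B i).
  by apply: leveled_sub (HAP i).1 => //; apply: fsubsetIl.
have [h lh hB] := leveled_glue Fd Edec BE lB.
exists h, (funion B); split=> //.
have Bd i j : i != j -> [disjoint B i & B j].
  move=> ij; apply/fdisjointP => n /(fsubsetP (BE i)) ni; apply/negP.
  by move=> /(fsubsetP (BE j)); apply/negP/(fdisjointP (Ed _ _ ij)).
have sumB : leveled_sum h (funion B) x =
    theta * \sum_(i < k) leveled_sum (HA i).1 (HA i).2 (coord_restrict (E i) x).
  rewrite /leveled_sum (sum_funion _ Bd) mulr_sumr; apply: eq_bigr => i _.
  rewrite mulr_sumr [RHS](big_fsetID _ (mem (E i))) /= [X in _ + X]big1_seq ?addr0.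
    apply: eq_fbig => n; first by rewrite in_fibre in_fsetI.
    move=> nB; rewrite (hB _ _ nB) exprS -mulrA /coord_restrict.
    by rewrite (fsubsetP (BE i) _ nB).
  move=> n /andP[_]; rewrite in_fibre => /andP[_ /negbTE nE].
  by rewrite /coord_restrict nE normr0 !mulr0.
rewrite sumB -lerBlDr; apply: (@le_trans _ _ (N x - eps1 - eps / 2)).
  by rewrite -addrA lerD2l -opprD lerN2 [leRHS](splitr eps) lerD2r.
rewrite lerBlDr; apply: le_trans (ltW sumE) _.
apply: (@le_trans _ _ (theta * \sum_(i < k) (leveled_sum (HA i).1 (HA i).2
   (coord_restrict (E i) x) + eps2))).
  by rewrite ler_pM2l //; apply: ler_sum => i _; case: (HAP i).
rewrite big_split /= mulrDr lerD2l sumr_const card_ord.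
apply: (@le_trans _ _ (eps2 *+ k)).
  by apply: ler_piMl; [rewrite mulrn_wge0 // ltW|apply: ltW].
rewrite -[eps2 *+ k]mulr_natr; apply: (@le_trans _ _ (eps2 * k.+1%:R)).
  by rewrite ler_pM2l // ler_nat.
by rewrite /eps2 divfK // pnatr_eq0.
Qed.

End ImplicitNorms.


(** * Comparison of the norms *)

Lemma leveled_norm_le (R : realType) (theta : R) (mono mono' : Prop)
    (F F' : {fset nat} -> Prop)
    (adm adm' : forall k, ('I_k -> {fset nat}) -> Prop) (N N' : (nat -> R) -> R) :
  0 < theta -> theta < 1 ->
  implicit_norm adm theta N -> implicit_norm adm' theta N' ->
  dom_closed F -> F fset0%fset ->
  (forall k (E : 'I_k -> {fset nat}), adm k E -> decomposition mono F E) ->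
  (forall k (E : 'I_k -> {fset nat}), decomposition mono' F' E -> adm' k E) ->
  (forall h A, leveled mono F h A -> leveled mono' F' h A) ->
  forall x, c00 x -> N x <= N' x.
Proof.
move=> t0 t1 NP NP' Fd F0 Fadm Fadm' FF' x cx.
apply/ler_addgt0Pr => eps eps0.
have [h [A [lA Ne]]] := norm_approx t0 t1 NP Fd F0 Fadm cx eps0.
apply: le_trans Ne _; rewrite lerD2r.
by apply: (leveled_sum_le_norm t0 t1 NP' Fadm' _ cx); apply: FF'.
Qed.


Theorem theorem4p2 (R : realType) (d : Order.disp_t) (W : orderType d)
    (omega1W : is_omega1 W) (alpha : W -> nat -> W)
    (alphaP : fundamental alpha) (xi : W)
    (theta : R) (theta_gt0 : 0 < theta) (theta_lt1 : theta < 1)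
    (N NM N2 : (nat -> R) -> R)
    (NP : tsirelson_norm (schreier alpha xi) theta N)
    (NMP : modified_tsirelson_norm (schreier alpha xi) theta NM)
    (N2P : tsirelson_norm
             (set_compose (schreier alpha xi) (card_le_family 2)) theta N2)
    (x : nat -> R) (xP : c00 x) :
  NM x <= N2 x /\ (N x <= NM x /\ NM x <= 3 * N x).
Proof.
have [wfW _ _] := omega1W.
set F := schreier alpha xi in NP NMP N2P.
have Fd : dom_closed F := @schreier_dom_closed _ _ _ wfW alphaP xi.
have F0 : F fset0%fset := schreier0 alphaP xi.
have F2 C : F C -> multiplied 2 F C.
  by move=> FC; exists C => // t; rewrite leq_pmull.
have adm_dec k (E : 'I_k -> {fset nat}) : admissible F E -> decomposition True F E.
  by move=> /admissible_decomposition.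
have dec_adm k (E : 'I_k -> {fset nat}) : decomposition True F E -> admissible F E.
  by move=> /admissible_decomposition.
have all_dec k (E : 'I_k -> {fset nat}) : allowable F E -> decomposition False F E.
  by move=> /allowable_decomposition.
have dec_all k (E : 'I_k -> {fset nat}) : decomposition False F E -> allowable F E.
  by move=> /allowable_decomposition.
have dec_adm2 k (E : 'I_k -> {fset nat}) : decomposition True (multiplied 2 F) E ->
    admissible (set_compose F (card_le_family 2)) E.
  case=> E0 Ed Es FE; apply/admissible_decomposition; split=> //.
  apply: multiplied_compose => //; apply/negP => /imfsetP[i _ m0].
  have [Ei0 /negP Ep] := E0 i; apply: Ep; rewrite m0.
  by case: (fminP Ei0).
(* For [xi = 0] a decomposition has at most one piece, so every allowable tree is admissible. *)
have [z|nz] := EM (is_zero xi).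
  have mono_zero B p : F [fset p n | n in B]%fset ->
      {in B &, {homo p : m n / (m <= n)%N}}.
    rewrite /F (schreier_zero_card _ _ z) => -[_ c1] m n mB nB _.
    have sub : ([fset p m; p n] `<=` [fset p k | k in B])%fset.
      apply/fsubsetP => a; rewrite in_fset2.
      by case/orP => /eqP ->; apply/imfsetP; [exists m|exists n].
    have := leq_trans (fsubset_leq_card sub) c1.
    by rewrite cardfs2; case: eqP => // ->.
  have mono01 h A : leveled False F h A -> leveled True F h A.
    apply: leveled_weaken => // _; right; exact: mono_zero.
  have le h A : leveled False F h A -> leveled True (multiplied 2 F) h A.
    apply: leveled_weaken => // _; right; exact: mono_zero.
  split; first exact: (leveled_norm_le _ _ NMP N2P Fd F0 all_dec dec_adm2 le).
  split.
    apply: (leveled_norm_le _ _ NP NMP Fd F0 adm_dec dec_all) => // h A.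
    by apply: leveled_weaken.
  have NMN : NM x <= N x.
    exact: (leveled_norm_le _ _ NMP NP Fd F0 all_dec dec_adm mono01).
  apply: le_trans NMN _.
  rewrite ler_peMl ?ler1n //.
  exact: le_trans (normr_ge0 (x 0%N)) (norm_ge_coord NP 0%N xP).
have F1 n : (0 < n)%N -> F [fset n]%fset.
  move=> n0; apply: schreier_card => //.
    by rewrite /posset /= in_fset1 eq_sym -lt0n.
  by move=> a; rewrite in_fset1 cardfs1 => /eqP ->.
have le h A : leveled False F h A -> leveled True (multiplied 2 F) h A.
  apply: leveled_monotone => // b c E1 E2 D1 D2.
  exact: schreier_union.
split; first exact: (leveled_norm_le _ _ NMP N2P Fd F0 all_dec dec_adm2 le).
split.
  apply: (leveled_norm_le _ _ NP NMP Fd F0 adm_dec dec_all) => // h A.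
  by apply: leveled_weaken.
(* A tree nearly attaining [NM x] is made successive for [F[A_2]] and then split into three
   admissible trees, each with sum at most [N x]. *)
apply/ler_addgt0Pr => eps eps0.
have [h [A [lA Ne]]] := norm_approx theta_gt0 theta_lt1 NMP Fd F0 all_dec xP eps0.
apply: le_trans Ne _; rewrite lerD2r.
have [j [_ j3 lj]] : exists j, [/\ {in A &, {homo j : m n / (m <= n)%N}},
    forall n, n \in A -> (j n < 3)%N &
    forall i, leveled True F h [fset n in A | j n == i]%fset].
  apply: leveled_split (le _ _ lA) => // C X FX CX.
  exact: (schreier_three wfW alphaP nz FX CX).
pose E (i : 'I_3) := [fset n in A | j n == i]%fset.
have -> : A = funion E.
  apply/fsetP => n; apply/idP/in_funion => [nA|[i]]; last first.
    by rewrite in_fibre => /andP[].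
  by exists (Ordinal (j3 n nA)); rewrite in_fibre nA eqxx.
have Ed i i' : i != i' -> [disjoint E i & E i']%fset.
  move=> ii'; apply/fdisjointP => n; rewrite !in_fibre => /andP[-> /eqP ->].
  by [].
rewrite /leveled_sum (sum_funion _ Ed).
apply: (@le_trans _ _ (\sum_(i < 3) N x)); last first.
  by rewrite sumr_const card_ord mulr_natl.
apply: ler_sum => i _.
exact: (leveled_sum_le_norm theta_gt0 theta_lt1 NP dec_adm (lj i) xP).
Qed.
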